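(* Let $F:\mathcal{T}_1\to\mathcal{T}_2$ be a monoidal triangulated equivalence between (non-zero) monoidal triangulated categories. Suppose $\mathbb{t}_1=(\mathcal{D}_1^{\leqslant 0},\mathcal{D}_1^{\geqslant 1})$ and $\mathbb{t}_2=(\mathcal{D}_2^{\leqslant 0},\mathcal{D}_2^{\geqslant 1})$ are monoidal t-structures on $\mathcal{T}_1$ and $\mathcal{T}_2$ respectively. Put $$\mathcal{U}=\{X\in\mathcal{T}_2\mid \exists\,\tilde X\in\mathcal{D}_1^{\leqslant 0}\text{ such that }F(\tilde X)\cong X\},\qquad \mathcal{V}=\{Y\in\mathcal{T}_2\mid \exists\,\tilde Y\in\mathcal{D}_1^{\geqslant 1}\text{ such that }F(\tilde Y)\cong Y\}.$$ Then: (1) $\mathbb{t}:=(\mathcal{U},\mathcal{V})$ is a monoidal t-structure on $\mathcal{T}_2$. (2) Suppose $0\in\mathrm{dev}(\mathbb{t}_1)$ and $\mathbb{t}_2$ is tensor reduced. If $\mathbb{t}$ and $\mathbb{t}_2$ are equivalent, then the restriction $F|_{\mathcal{H}_{\mathbb{t}_1}}:\mathcal{H}_{\mathbb{t}_1}\to\mathcal{H}_{\mathbb{t}_2}$ is a monoidal abelian equivalence.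
   Context: All categories are linear over an algebraically closed field $\mathbb{k}$. A monoidal triangulated category $(\mathcal{T},\otimes,\Sigma,\mathbb{1})$ is a triangulated category with shift $\Sigma$ that is also monoidal with unit $\mathbb{1}$ such that $\otimes$ is exact (triangulated) in each variable; this involves isomorphisms $\Sigma(X)\otimes Y\cong\Sigma(X\otimes Y)\cong X\otimes\Sigma(Y)$ natural in $X,Y$ (no further compatibility is required). A monoidal triangulated functor is a triangulated functor respecting the monoidal structures and sending the unit to the unit; it is a monoidal triangulated equivalence if it is also an equivalence. A monoidal abelian equivalence is a (strong) monoidal functor between monoidal abelian categories that is an equivalence. A t-structure on $\mathcal{T}$ is a pair of full strict subcategories $\mathbb{t}=(\mathcal{D}^{\leqslant 0},\mathcal{D}^{\geqslant 1})$ with $\Sigma\mathcal{D}^{\leqslant 0}\subseteq\mathcal{D}^{\leqslant 0}$, $\mathcal{D}^{\geqslant 1}\subseteq\Sigma\mathcal{D}^{\geqslant 1}$, $\mathrm{Hom}_{\mathcal{T}}(\mathcal{D}^{\leqslant 0},\mathcal{D}^{\geqslant 1})=0$, and for each $X\in\mathcal{T}$ a distinguished triangle $X^{\leqslant 0}\to X\to X^{\geqslant 1}\to\Sigma X^{\leqslant 0}$ with $X^{\leqslant 0}\in\mathcal{D}^{\leqslant 0}$, $X^{\geqslant 1}\in\mathcal{D}^{\geqslant 1}$. Put $\mathcal{D}^{\leqslant n}:=\Sigma^{-n}\mathcal{D}^{\leqslant 0}$, $\mathcal{D}^{\geqslant n+1}:=\Sigma^{-n}\mathcal{D}^{\geqslant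 1}$; the heart is the abelian category $\mathcal{H}_{\mathbb{t}}:=\mathcal{D}^{\leqslant 0}\cap\mathcal{D}^{\geqslant 0}$. $\mathbb{t}$ is bounded if $\bigcup_n\mathcal{D}^{\leqslant n}=\mathcal{T}=\bigcup_n\mathcal{D}^{\geqslant n}$. Two t-structures with aisles $\mathcal{D}^{\leqslant 0}$ and $\mathcal{E}^{\leqslant 0}$ on the same category are equivalent if there are integers $m\leqslant n$ with $\mathcal{D}^{\leqslant m}\subseteq\mathcal{E}^{\leqslant 0}\subseteq\mathcal{D}^{\leqslant n}$. A monoidal t-structure is a bounded t-structure for which there exists $n\in\mathbb{Z}$ with $\mathcal{D}^{\leqslant 0}\otimes\mathcal{D}^{\leqslant n}\subseteq\mathcal{D}^{\leqslant 0}$ and $\mathcal{D}^{\geqslant 0}\otimes\mathcal{D}^{\geqslant n}\subseteq\mathcal{D}^{\geqslant 0}$; the set of all such $n$ is the deviation $\mathrm{dev}(\mathbb{t})$. If $0\in\mathrm{dev}(\mathbb{t})$, then $\mathcal{H}_{\mathbb{t}}$ is a monoidal abelian category under the tensor product of $\mathcal{T}$, with unit $H^0_{\mathbb{t}}(\mathbb{1})$, where $H^0_{\mathbb{t}}=\tau^{\leqslant 0}_{\mathbb{t}}\tau^{\geqslant 0}_{\mathbb{t}}$ is the cohomological functor of $\mathbb{t}$. A monoidal additive category $\mathcal{C}$ is tensor reduced if for every object $X$, $X\otimes X=0$ if and only if $X=0$. A monoidal t-structure $\mathbb{t}$ is tensor reduced if $0\in\mathrm{dev}(\mathbb{t})$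 and its heart $\mathcal{H}_{\mathbb{t}}$ is tensor reduced. *)

(* Defs.v *)
From mathcomp Require Import all_boot all_order all_algebra.

Set Implicit Arguments.
Unset Strict Implicit.
Unset Printing Implicit Defensive.

Import Order.TTheory GRing.Theory Num.Theory.
Local Open Scope ring_scope.

Declare Scope cat_scope.
Delimit Scope cat_scope with cat.

(** * Linear categories, functors, equivalences *)

Record linCat (k : fieldType) : Type := LinCat {
  obj :> Type;
  mor : obj -> obj -> lmodType k;
  idmor : forall X : obj, mor X X;
  mcomp : forall X Y Z : obj, mor Y Z -> mor X Y -> mor X Z;
  mcomp1m : forall (X Y : obj) (f : mor X Y), mcomp (idmor Y) f = f;
  mcompm1 : forall (X Y : obj) (f : mor X Y), mcomp f (idmor X) = f;
  mcompA : forall (X Y Z W : obj) (h : mor Z W) (g : mor Y Z) (f : mor X Y),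
    mcomp h (mcomp g f) = mcomp (mcomp h g) f;
  mcomp_linl : forall (X Y Z : obj) (f : mor X Y),
    linear (fun g : mor Y Z => mcomp g f);
  mcomp_linr : forall (X Y Z : obj) (g : mor Y Z),
    linear (fun f : mor X Y => mcomp g f)
}.

Arguments mor {k l} _ _.
Arguments idmor {k l} _.
Arguments mcomp {k l X Y Z} _ _.

Notation "g \c f" := (mcomp g f)
  (at level 40, left associativity) : cat_scope.
Local Open Scope cat_scope.

Definition inverse_pair (k : fieldType) (C : linCat k) (X Y : C)
    (f : mor X Y) (g : mor Y X) : Prop :=
  g \c f = idmor X /\ f \c g = idmor Y.

Definition is_iso (k : fieldType) (C : linCat k) (X Y : C) (f : mor X Y)
    : Prop :=
  exists g : mor Y X, inverse_pair f g.

Definition isomorphic (k : fieldType) (C : linCat k) (X Y : C) : Prop :=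
  exists f : mor X Y, is_iso f.

(* Each mor space contains 0, so "unique" reduces to "equal to 0". *)
Definition is_zero (k : fieldType) (C : linCat k) (X : C) : Prop :=
  (forall (Y : C) (f : mor X Y), f = 0) /\
  (forall (Y : C) (f : mor Y X), f = 0).

Definition nonzero_cat (k : fieldType) (C : linCat k) : Prop :=
  ~ (forall X : C, is_zero X).

Record linFunctor (k : fieldType) (C D : linCat k) : Type := LinFunctor {
  fobj :> C -> D;
  fmap : forall X Y : C, mor X Y -> mor (fobj X) (fobj Y);
  fmap_id : forall X : C, fmap (idmor X) = idmor (fobj X);
  fmap_comp : forall (X Y Z : C) (g : mor Y Z) (f : mor X Y),
    fmap (g \c f) = fmap g \c fmap f;
  fmap_lin : forall X Y : C, linear (@fmap X Y)
}.

Arguments fmap {k C D} l {X Y} _.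

Definition id_functor (k : fieldType) (C : linCat k) : linFunctor C C :=
  @LinFunctor k C C (fun X => X) (fun X Y f => f)
    (fun X => erefl) (fun X Y Z g f => erefl) (fun X Y a u v => erefl).

Lemma comp_functor_id (k : fieldType) (C D E : linCat k)
    (G : linFunctor D E) (F : linFunctor C D) (X : C) :
  fmap G (fmap F (idmor X)) = idmor (G (F X)).
Proof. by rewrite !fmap_id. Qed.

Lemma comp_functor_comp (k : fieldType) (C D E : linCat k)
    (G : linFunctor D E) (F : linFunctor C D)
    (X Y Z : C) (g : mor Y Z) (f : mor X Y) :
  fmap G (fmap F (g \c f)) = fmap G (fmap F g) \c fmap G (fmap F f).
Proof. by rewrite !fmap_comp. Qed.

Lemma comp_functor_lin (k : fieldType) (C D E : linCat k)
    (G : linFunctor D E) (F : linFunctor C D) (X Y : C) :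
  linear (fun f : mor X Y => fmap G (fmap F f)).
Proof. by move=> a u v; rewrite (fmap_lin F) (fmap_lin G). Qed.

Definition comp_functor (k : fieldType) (C D E : linCat k)
    (G : linFunctor D E) (F : linFunctor C D) : linFunctor C E :=
  @LinFunctor k C E (fun X => G (F X)) (fun X Y f => fmap G (fmap F f))
    (comp_functor_id G F) (comp_functor_comp G F) (comp_functor_lin G F).

Definition is_nat_iso (k : fieldType) (C D : linCat k) (F G : linFunctor C D)
    (a : forall X : C, mor (F X) (G X)) : Prop :=
  (forall (X Y : C) (f : mor X Y), a Y \c fmap F f = fmap G f \c a X) /\
  (forall X : C, is_iso (a X)).

Definition nat_isomorphic (k : fieldType) (C D : linCat k)
    (F G : linFunctor C D) : Prop :=
  exists a : forall X : C, mor (F X) (G X), is_nat_iso a.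

Definition is_equivalence (k : fieldType) (C D : linCat k)
    (F : linFunctor C D) : Prop :=
  exists G : linFunctor D C,
    nat_isomorphic (comp_functor G F) (id_functor C) /\
    nat_isomorphic (comp_functor F G) (id_functor D).

(** * Additive and abelian categories *)

Definition is_biproduct (k : fieldType) (C : linCat k) (X Y B : C)
    (i1 : mor X B) (i2 : mor Y B) (p1 : mor B X) (p2 : mor B Y) : Prop :=
  [/\ p1 \c i1 = idmor X, p2 \c i2 = idmor Y
    & (i1 \c p1 : mor B B) + i2 \c p2 = idmor B].

Definition is_additive (k : fieldType) (C : linCat k) : Prop :=
  (exists Z : C, is_zero Z) /\
  (forall X Y : C, exists (B : C) (i1 : mor X B) (i2 : mor Y B)
     (p1 : mor B X) (p2 : mor B Y), is_biproduct i1 i2 p1 p2).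

Definition is_kernel (k : fieldType) (C : linCat k) (K X Y : C)
    (i : mor K X) (f : mor X Y) : Prop :=
  f \c i = 0 /\
  forall (W : C) (g : mor W X), f \c g = 0 -> exists! h : mor W K, i \c h = g.

Definition is_cokernel (k : fieldType) (C : linCat k) (X Y Q : C)
    (p : mor Y Q) (f : mor X Y) : Prop :=
  p \c f = 0 /\
  forall (W : C) (g : mor Y W), g \c f = 0 -> exists! h : mor Q W, h \c p = g.

Definition is_mono (k : fieldType) (C : linCat k) (X Y : C) (f : mor X Y)
    : Prop :=
  forall (W : C) (g h : mor W X), f \c g = f \c h -> g = h.

Definition is_epi (k : fieldType) (C : linCat k) (X Y : C) (f : mor X Y)
    : Prop :=
  forall (W : C) (g h : mor Y W), g \c f = h \c f -> g = h.

Record is_abelian (k : fieldType) (C : linCat k) : Prop := IsAbelian {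
  ab_additive : is_additive C;
  ab_kernel : forall (X Y : C) (f : mor X Y),
    exists (K : C) (i : mor K X), is_kernel i f;
  ab_cokernel : forall (X Y : C) (f : mor X Y),
    exists (Q : C) (p : mor Y Q), is_cokernel p f;
  ab_mono : forall (X Y : C) (f : mor X Y), is_mono f ->
    exists (Z : C) (g : mor Y Z), is_kernel f g;
  ab_epi : forall (X Y : C) (f : mor X Y), is_epi f ->
    exists (Z : C) (g : mor Z X), is_cokernel f g
}.

(** * Monoidal categories *)

Record bifunctor (k : fieldType) (C : linCat k) : Type := Bifunctor {
  tobj :> C -> C -> C;
  tmap : forall X X' Y Y' : C,
    mor X X' -> mor Y Y' -> mor (tobj X Y) (tobj X' Y');
  tmap_id : forall X Y : C, tmap (idmor X) (idmor Y) = idmor (tobj X Y);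
  tmap_comp : forall (X X' X'' Y Y' Y'' : C)
      (f' : mor X' X'') (f : mor X X') (g' : mor Y' Y'') (g : mor Y Y'),
    tmap (f' \c f) (g' \c g) = tmap f' g' \c tmap f g;
  tmap_linl : forall (X X' Y Y' : C) (g : mor Y Y'),
    linear (fun f : mor X X' => tmap f g);
  tmap_linr : forall (X X' Y Y' : C) (f : mor X X'),
    linear (fun g : mor Y Y' => tmap f g)
}.

Arguments tmap {k C} b {X X' Y Y'} _ _.

Lemma tens_r_comp (k : fieldType) (C : linCat k) (T : bifunctor C) (Y : C)
    (X X' X'' : C) (g : mor X' X'') (f : mor X X') :
  tmap T (g \c f) (idmor Y) = tmap T g (idmor Y) \c tmap T f (idmor Y).
Proof. by rewrite -tmap_comp mcomp1m. Qed.

Lemma tens_l_comp (k : fieldType) (C : linCat k) (T : bifunctor C) (X : C)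
    (Y Y' Y'' : C) (g : mor Y' Y'') (f : mor Y Y') :
  tmap T (idmor X) (g \c f) = tmap T (idmor X) g \c tmap T (idmor X) f.
Proof. by rewrite -tmap_comp mcomp1m. Qed.

(* The functor - (x) Y. *)
Definition tens_r (k : fieldType) (C : linCat k) (T : bifunctor C) (Y : C)
    : linFunctor C C :=
  @LinFunctor k C C (fun X => T X Y) (fun X X' f => tmap T f (idmor Y))
    (fun X => tmap_id T X Y) (@tens_r_comp k C T Y)
    (fun X X' => @tmap_linl k C T X X' Y Y (idmor Y)).

(* The functor X (x) -. *)
Definition tens_l (k : fieldType) (C : linCat k) (T : bifunctor C) (X : C)
    : linFunctor C C :=
  @LinFunctor k C C (fun Y => T X Y) (fun Y Y' g => tmap T (idmor X) g)
    (fun Y => tmap_id T X Y) (@tens_l_comp k C T X)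
    (fun Y Y' => @tmap_linr k C T X X Y Y' (idmor X)).

Record monoidal (k : fieldType) (C : linCat k) (T : bifunctor C) : Type :=
    Monoidal {
  mon_unit : C;
  mon_a : forall X Y Z : C, mor (T (T X Y) Z) (T X (T Y Z));
  mon_l : forall X : C, mor (T mon_unit X) X;
  mon_r : forall X : C, mor (T X mon_unit) X;
  mon_a_iso : forall X Y Z : C, is_iso (mon_a X Y Z);
  mon_a_nat : forall (X X' Y Y' Z Z' : C)
      (f : mor X X') (g : mor Y Y') (h : mor Z Z'),
    mon_a X' Y' Z' \c tmap T (tmap T f g) h
      = tmap T f (tmap T g h) \c mon_a X Y Z;
  mon_l_iso : forall X : C, is_iso (mon_l X);
  mon_l_nat : forall (X X' : C) (f : mor X X'),
    mon_l X' \c tmap T (idmor mon_unit) f = f \c mon_l X;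
  mon_r_iso : forall X : C, is_iso (mon_r X);
  mon_r_nat : forall (X X' : C) (f : mor X X'),
    mon_r X' \c tmap T f (idmor mon_unit) = f \c mon_r X;
  mon_pentagon : forall X Y Z W : C,
    mon_a X Y (T Z W) \c mon_a (T X Y) Z W
      = tmap T (idmor X) (mon_a Y Z W) \c mon_a X (T Y Z) W
          \c tmap T (mon_a X Y Z) (idmor W);
  mon_triangle : forall X Y : C,
    tmap T (idmor X) (mon_l Y) \c mon_a X mon_unit Y = tmap T (mon_r X) (idmor Y)
}.

Arguments mon_unit {k C T} _.
Arguments mon_a {k C T} _ _ _ _.
Arguments mon_l {k C T} _ _.
Arguments mon_r {k C T} _ _.

Definition tensor_reduced (k : fieldType) (C : linCat k) (T : bifunctor C)
    : Prop :=
  forall X : C, is_zero (T X X) <-> is_zero X.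

Record is_strong_monoidal (k : fieldType) (C D : linCat k)
    (TC : bifunctor C) (TD : bifunctor D)
    (MC : monoidal TC) (MD : monoidal TD) (F : linFunctor C D)
    (mu : forall X Y : C, mor (TD (F X) (F Y)) (F (TC X Y)))
    (eps : mor (mon_unit MD) (F (mon_unit MC))) : Prop := IsStrongMonoidal {
  sm_mu_iso : forall X Y : C, is_iso (mu X Y);
  sm_mu_nat : forall (X X' Y Y' : C) (f : mor X X') (g : mor Y Y'),
    mu X' Y' \c tmap TD (fmap F f) (fmap F g)
      = fmap F (tmap TC f g) \c mu X Y;
  sm_eps_iso : is_iso eps;
  sm_assoc : forall X Y Z : C,
    fmap F (mon_a MC X Y Z) \c mu (TC X Y) Z \c tmap TD (mu X Y) (idmor (F Z))
      = mu X (TC Y Z) \c tmap TD (idmor (F X)) (mu Y Z)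
          \c mon_a MD (F X) (F Y) (F Z);
  sm_unit_l : forall X : C,
    fmap F (mon_l MC X) \c mu (mon_unit MC) X \c tmap TD eps (idmor (F X))
      = mon_l MD (F X);
  sm_unit_r : forall X : C,
    fmap F (mon_r MC X) \c mu X (mon_unit MC) \c tmap TD (idmor (F X)) eps
      = mon_r MD (F X)
}.

Definition monoidal_abelian_equivalence (k : fieldType) (C D : linCat k)
    (TC : bifunctor C) (TD : bifunctor D)
    (MC : monoidal TC) (MD : monoidal TD) (F : linFunctor C D)
    (mu : forall X Y : C, mor (TD (F X) (F Y)) (F (TC X Y)))
    (eps : mor (mon_unit MD) (F (mon_unit MC))) : Prop :=
  [/\ is_abelian C, is_abelian D, is_strong_monoidal mu eps
    & is_equivalence F].

(** * Triangulated categories *)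

(* The shift is an autoequivalence given with a quasi-inverse [shV];
   [dist f g h] means that X -f-> Y -g-> Z -h-> sh X is distinguished. *)
Record triCat (k : fieldType) : Type := TriCat {
  tri_cat :> linCat k;
  tri_additive : is_additive tri_cat;
  sh : linFunctor tri_cat tri_cat;
  shV : linFunctor tri_cat tri_cat;
  shVK : nat_isomorphic (comp_functor sh shV) (id_functor tri_cat);
  shK : nat_isomorphic (comp_functor shV sh) (id_functor tri_cat);
  dist : forall X Y Z : tri_cat, mor X Y -> mor Y Z -> mor Z (sh X) -> Prop;
  tr1_id : forall X : tri_cat, exists Z : tri_cat,
    is_zero Z /\ dist (idmor X) (0 : mor X Z) 0;
  tr1_cone : forall (X Y : tri_cat) (f : mor X Y),
    exists (Z : tri_cat) (g : mor Y Z) (h : mor Z (sh X)), dist f g h;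
  tr1_iso : forall (X Y Z X' Y' Z' : tri_cat)
      (f : mor X Y) (g : mor Y Z) (h : mor Z (sh X))
      (f' : mor X' Y') (g' : mor Y' Z') (h' : mor Z' (sh X'))
      (u : mor X X') (v : mor Y Y') (w : mor Z Z'),
    is_iso u -> is_iso v -> is_iso w ->
    v \c f = f' \c u -> w \c g = g' \c v -> fmap sh u \c h = h' \c w ->
    dist f g h -> dist f' g' h';
  tr2 : forall (X Y Z : tri_cat)
      (f : mor X Y) (g : mor Y Z) (h : mor Z (sh X)),
    dist f g h <-> dist g h (- fmap sh f);
  tr3 : forall (X Y Z X' Y' Z' : tri_cat)
      (f : mor X Y) (g : mor Y Z) (h : mor Z (sh X))
      (f' : mor X' Y') (g' : mor Y' Z') (h' : mor Z' (sh X'))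
      (u : mor X X') (v : mor Y Y'),
    dist f g h -> dist f' g' h' -> v \c f = f' \c u ->
    exists w : mor Z Z', w \c g = g' \c v /\ fmap sh u \c h = h' \c w;
  tr4 : forall (X Y Z A B C : tri_cat) (f : mor X Y) (g : mor Y Z)
      (f1 : mor Y A) (f2 : mor A (sh X))
      (g1 : mor Z B) (g2 : mor B (sh Y))
      (h1 : mor Z C) (h2 : mor C (sh X)),
    dist f f1 f2 -> dist g g1 g2 -> dist (g \c f) h1 h2 ->
    exists (u : mor A C) (v : mor C B),
      [/\ dist u v (fmap sh f1 \c g2),
          u \c f1 = h1 \c g /\ h2 \c u = f2
        & v \c h1 = g1 /\ g2 \c v = fmap sh f \c h2]
}.

Arguments sh {k} t.
Arguments shV {k} t.
Arguments dist {k t X Y Z} _ _ _.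

Record is_exact_functor (k : fieldType) (T1 T2 : triCat k)
    (F : linFunctor T1 T2) (theta : forall X : T1, mor (F (sh T1 X)) (sh T2 (F X)))
    : Prop := IsExactFunctor {
  ex_nat_iso :
    @is_nat_iso k T1 T2 (comp_functor F (sh T1)) (comp_functor (sh T2) F) theta;
  ex_dist : forall (X Y Z : T1)
      (f : mor X Y) (g : mor Y Z) (h : mor Z (sh T1 X)),
    dist f g h -> dist (fmap F f) (fmap F g) (theta X \c fmap F h)
}.

Record mtCat (k : fieldType) : Type := MTCat {
  mt_tri :> triCat k;
  tens : bifunctor mt_tri;
  mon : monoidal tens;
  tens_shl : forall X Y : mt_tri,
    mor (tens (sh mt_tri X) Y) (sh mt_tri (tens X Y));
  tens_shr : forall X Y : mt_tri,
    mor (tens X (sh mt_tri Y)) (sh mt_tri (tens X Y));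
  tens_exactl : forall Y : mt_tri,
    @is_exact_functor k mt_tri mt_tri (tens_r tens Y) (fun X => tens_shl X Y);
  tens_exactr : forall X : mt_tri,
    @is_exact_functor k mt_tri mt_tri (tens_l tens X) (fun Y => tens_shr X Y);
  tens_shl_nat : forall (X Y Y' : mt_tri) (g : mor Y Y'),
    tens_shl X Y' \c tmap tens (idmor (sh mt_tri X)) g
      = fmap (sh mt_tri) (tmap tens (idmor X) g) \c tens_shl X Y;
  tens_shr_nat : forall (X X' Y : mt_tri) (f : mor X X'),
    tens_shr X' Y \c tmap tens f (idmor (sh mt_tri Y))
      = fmap (sh mt_tri) (tmap tens f (idmor Y)) \c tens_shr X Y
}.

Arguments tens {k} m.
Arguments mon {k} m.

Record mtFunctor (k : fieldType) (T1 T2 : mtCat k) : Type := MTFunctor {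
  mtf :> linFunctor T1 T2;
  mtf_sh : forall X : T1, mor (mtf (sh T1 X)) (sh T2 (mtf X));
  mtf_exact : is_exact_functor mtf_sh;
  mtf_mu : forall X Y : T1,
    mor (tens T2 (mtf X) (mtf Y)) (mtf (tens T1 X Y));
  mtf_eps : mor (mon_unit (mon T2)) (mtf (mon_unit (mon T1)));
  mtf_monoidal : is_strong_monoidal mtf_mu mtf_eps
}.

(** * t-structures *)

Definition shiftz (k : fieldType) (T : triCat k) (n : int) (X : T) : T :=
  match n with
  | Posz m => iter m (sh T) X
  | Negz m => iter m.+1 (shV T) X
  end.

(* Strict closure of the image of the full subcategory P under Sigma^n. *)
Definition shift_sub (k : fieldType) (T : triCat k) (n : int) (P : T -> Prop)
    (X : T) : Prop :=
  exists Y : T, P Y /\ isomorphic X (shiftz n Y).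

Record tPair (k : fieldType) (T : triCat k) : Type := TPair {
  aisle : T -> Prop;
  coaisle : T -> Prop
}.

(* D^{<= n} = Sigma^{-n} D^{<= 0} and D^{>= n} = Sigma^{1-n} D^{>= 1}. *)
Definition tle (k : fieldType) (T : triCat k) (t : tPair T) (n : int)
    : T -> Prop := shift_sub (- n) (aisle t).

Definition tge (k : fieldType) (T : triCat k) (t : tPair T) (n : int)
    : T -> Prop := shift_sub (1 - n) (coaisle t).

Definition strict_sub (k : fieldType) (C : linCat k) (P : C -> Prop) : Prop :=
  forall X Y : C, isomorphic X Y -> P X -> P Y.

Record is_tstructure (k : fieldType) (T : triCat k) (t : tPair T) : Prop :=
    IsTStructure {
  ts_strict_aisle : strict_sub (aisle t);
  ts_strict_coaisle : strict_sub (coaisle t);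
  ts_aisle_shift : forall X : T, aisle t X -> aisle t (sh T X);
  ts_coaisle_shift : forall X : T, coaisle t X -> shift_sub 1 (coaisle t) X;
  ts_orth : forall (X Y : T) (f : mor X Y), aisle t X -> coaisle t Y -> f = 0;
  ts_triangle : forall X : T, exists (A B : T)
      (a : mor A X) (p : mor X B) (d : mor B (sh T A)),
    [/\ aisle t A, coaisle t B & dist a p d]
}.

Definition is_bounded (k : fieldType) (T : triCat k) (t : tPair T) : Prop :=
  (forall X : T, exists n : int, tle t n X) /\
  (forall X : T, exists n : int, tge t n X).

Definition t_equivalent (k : fieldType) (T : triCat k) (t s : tPair T)
    : Prop :=
  exists m n : int,
    [/\ m <= n, forall X : T, tle t m X -> aisle s X
      & forall X : T, aisle s X -> tle t n X].

(** * Hearts *)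

Definition full_sub (k : fieldType) (C : linCat k) (P : C -> Prop)
    : linCat k :=
  @LinCat k {X : C | P X} (fun X Y => mor (sval X) (sval Y))
    (fun X => idmor (sval X)) (fun X Y Z g f => g \c f)
    (fun X Y f => mcomp1m f) (fun X Y f => mcompm1 f)
    (fun X Y Z W h g f => mcompA h g f)
    (fun X Y Z f => mcomp_linl f) (fun X Y Z g => mcomp_linr g).

Definition restrict_functor (k : fieldType) (C D : linCat k)
    (F : linFunctor C D) (P : C -> Prop) (Q : D -> Prop)
    (hF : forall X : C, P X -> Q (F X))
    : linFunctor (full_sub P) (full_sub Q) :=
  @LinFunctor k (full_sub P) (full_sub Q)
    (fun X => exist Q (F (sval X)) (hF (sval X) (svalP X)))
    (fun X Y f => fmap F f)
    (fun X => fmap_id F (sval X))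
    (fun X Y Z g f => fmap_comp F g f)
    (fun X Y => @fmap_lin k C D F (sval X) (sval Y)).

Definition restrict_bifunctor (k : fieldType) (C : linCat k) (T : bifunctor C)
    (P : C -> Prop) (hT : forall X Y : C, P X -> P Y -> P (T X Y))
    : bifunctor (full_sub P) :=
  @Bifunctor k (full_sub P)
    (fun X Y => exist P (T (sval X) (sval Y))
                  (hT (sval X) (sval Y) (svalP X) (svalP Y)))
    (fun X X' Y Y' f g => tmap T f g)
    (fun X Y => tmap_id T (sval X) (sval Y))
    (fun X X' X'' Y Y' Y'' f' f g' g => tmap_comp T f' f g' g)
    (fun X X' Y Y' g => @tmap_linl k C T (sval X) (sval X') _ _ g)
    (fun X X' Y Y' f => @tmap_linr k C T _ _ (sval Y) (sval Y') f).

Definition in_heart (k : fieldType) (T : triCat k) (t : tPair T) (X : T)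
    : Prop := tle t 0 X /\ tge t 0 X.

Definition heart (k : fieldType) (T : triCat k) (t : tPair T) : linCat k :=
  full_sub (in_heart t).

(** * Monoidal t-structures *)

Definition dev (k : fieldType) (T : mtCat k) (t : tPair T) (n : int) : Prop :=
  (forall X Y : T, tle t 0 X -> tle t n Y -> tle t 0 (tens T X Y)) /\
  (forall X Y : T, tge t 0 X -> tge t n Y -> tge t 0 (tens T X Y)).

Record is_monoidal_tstructure (k : fieldType) (T : mtCat k) (t : tPair T)
    : Prop := IsMonoidalTStructure {
  mts_tstructure : is_tstructure t;
  mts_bounded : is_bounded t;
  mts_dev : exists n : int, dev t n
}.

Lemma tens_in_heart (k : fieldType) (T : mtCat k) (t : tPair T)
    (h : dev t 0) (X Y : T) :
  in_heart t X -> in_heart t Y -> in_heart t (tens T X Y).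
Proof. by move=> [lX gX] [lY gY]; split; [apply: h.1|apply: h.2]. Qed.

Definition heart_tens (k : fieldType) (T : mtCat k) (t : tPair T)
    (h : dev t 0) : bifunctor (heart t) :=
  restrict_bifunctor (tens_in_heart h).

Record is_tensor_reduced_tstructure (k : fieldType) (T : mtCat k) (t : tPair T)
    : Prop := IsTensorReducedTStructure {
  trt_monoidal : is_monoidal_tstructure t;
  trt_dev : dev t 0;
  trt_reduced : tensor_reduced (heart_tens trt_dev)
}.

(* X -p-> B is the truncation X -> tau^{>= 0} X and H -i-> B is the truncation
   tau^{<= 0} B -> B, i.e. H = H^0(X).  Truncations are unique only up to
   unique isomorphism, so the maps are part of the data. *)
Definition is_H0 (k : fieldType) (T : triCat k) (t : tPair T) (X B H : T)
    (p : mor X B) (i : mor H B) : Prop :=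
  (exists (A : T) (a : mor A X) (d : mor B (sh T A)),
     [/\ tle t (-1) A, tge t 0 B & dist a p d]) /\
  (exists (C : T) (c : mor B C) (d : mor C (sh T H)),
     [/\ tle t 0 H, tge t 1 C & dist i c d]).

(* The monoidal structure of the heart: the tensor product and associator of T,
   with unit H^0(1).  With 1 -p-> tau^{>= 0} 1 <-i- H^0(1), the left unitor
   H^0(1) (x) X -> X is (p (x) X) o l_X^{-1} cancelled from i (x) X, where
   l_X : 1 (x) X -> X is that of T; symmetrically on the right. *)
Definition is_heart_monoidal (k : fieldType) (T : mtCat k) (t : tPair T)
    (h : dev t 0) (M : monoidal (heart_tens h)) : Prop :=
  (forall X Y Z : heart t,
     mon_a M X Y Z = mon_a (mon T) (sval X) (sval Y) (sval Z)) /\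
  exists (B : T) (p : mor (mon_unit (mon T)) B)
         (i : mor (sval (mon_unit M)) B),
    [/\ is_H0 t p i,
        forall X : heart t, exists v,
          inverse_pair (mon_l (mon T) (sval X)) v /\
          tmap (tens T) p (idmor (sval X)) \c v
            \c (mon_l M X : @mor k T (tens T (sval (mon_unit M)) (sval X))
                                     (sval X))
            = tmap (tens T) i (idmor (sval X))
      & forall X : heart t, exists v,
          inverse_pair (mon_r (mon T) (sval X)) v /\
          tmap (tens T) (idmor (sval X)) p \c v
            \c (mon_r M X : @mor k T (tens T (sval X) (sval (mon_unit M)))
                                     (sval X))
            = tmap (tens T) (idmor (sval X)) i].

(** * Transport of t-structures along a functor *)

Definition ess_image (k : fieldType) (C D : linCat k) (F : linFunctor C D)
    (P : C -> Prop) (X : D) : Prop :=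
  exists X' : C, P X' /\ isomorphic (F X') X.

Definition image_tpair (k : fieldType) (T1 T2 : triCat k)
    (F : linFunctor T1 T2) (t : tPair T1) : tPair T2 :=
  TPair (ess_image F (aisle t)) (ess_image F (coaisle t)).

Definition restrict_mu (k : fieldType) (T1 T2 : mtCat k) (F : mtFunctor T1 T2)
    (t1 : tPair T1) (t2 : tPair T2) (h1 : dev t1 0) (h2 : dev t2 0)
    (hF : forall X : T1, in_heart t1 X -> in_heart t2 (F X))
    (X Y : heart t1) :
    mor (heart_tens h2 (restrict_functor hF X) (restrict_functor hF Y))
        (restrict_functor hF (heart_tens h1 X Y)) :=
  mtf_mu F (sval X) (sval Y).

(* Main.v *)
Require Import Defs.
From Stdlib Require Import Setoid.
From mathcomp Require Import all_boot all_order all_algebra.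
From mathcomp Require Import zify.

Set Implicit Arguments.
Unset Strict Implicit.
Unset Printing Implicit Defensive.

Import Order.TTheory GRing.Theory Num.Theory.
Local Open Scope ring_scope.
Local Open Scope cat_scope.

(** Write [t] for the transport of [t1] along [F].  The first claim holds
    because [F] carries shifts, distinguished triangles and tensor products to
    their counterparts, and is fully faithful and essentially surjective
    ([tle_image], [tge_image], [image_tstructure], [image_dev]).

    For the second claim the point is that [t] and [t2] are not merely
    equivalent: they are equal.  Let [X] lie in [D^{<= n}] of [t2], and let
    [B = Sigma^{-n} H^n(X)] be the last piece of its truncation.  A Kuenneth
    argument at the top degree gives [H^{2n}(X (x) X) = H^n(X) (x) H^n(X)], and
    for a tensor reduced [t2] the right side vanishes only if [H^n(X)] does.
    Hence if [X (x) X] lies in [D^{<= 2n-1}] then [X] lies in [D^{<= n-1}]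
    ([tle_drop], and dually [tge_drop]).  A class of objects that is closed
    under squares and bounded above by some [n > 0] is therefore bounded above
    by [n - 1], as [n <= 2n - 1]; going down, it lies in [D^{<= 0}]
    ([square_closed_tle], [square_closed_tge]).

    This principle is applied to three classes.  The aisle and the
    [>= 0]-part of [t] are closed under squares since [0] is in the deviation
    of [t1], and bounded with respect to [t2] by equivalence; so
    [t^{<= 0}] is inside [t2^{<= 0}] and [t^{>= 0}] is inside [t2^{>= 0}], and
    orthogonality turns the two inclusions into equalities
    ([equivalent_tensor_reduced_eq]).  The isomorphism class of the unit is
    closed under squares too, so the unit lies in the heart ([unit_in_heart]);
    thus [H^0(1) = 1], and the monoidal structure of the heart is the plain
    restriction of the ambient one ([heart_monoidal]).

    Consequently [F X] is in the heart of [t2] exactly when [X] is in the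
    heart of [t1], and the equivalence, its quasi-inverse and its monoidal
    constraints all restrict to the hearts.  The hearts are abelian by the
    theorem of Beilinson, Bernstein and Deligne ([heart_abelian]). *)

(** * Linear categories and functors *)

Section LinearMaps.
Variables (k : fieldType) (U V : lmodType k) (f : U -> V).
Hypothesis f_lin : linear f.

Lemma lin_map0 : f 0 = 0.
Proof. by have := f_lin (-1) 0 0; rewrite !scaleN1r oppr0 addr0 addNr. Qed.

Lemma lin_mapN u : f (- u) = - f u.
Proof. by have := f_lin (-1) u 0; rewrite !scaleN1r lin_map0 !addr0. Qed.

Lemma lin_mapB u v : f (u - v) = f u - f v.
Proof. by have := f_lin (-1) v u; rewrite !scaleN1r ![- _ + _]addrC. Qed.

Lemma lin_mapD u v : f (u + v) = f u + f v.
Proof. by have := f_lin 1 u v; rewrite !scale1r. Qed.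

End LinearMaps.

Section LinearCategory.
Variables (k : fieldType) (C : linCat k).
Implicit Types X Y Z W : C.

Lemma comp0m X Y Z (f : mor X Y) : (0 : mor Y Z) \c f = 0.
Proof. exact: lin_map0 (mcomp_linl f). Qed.

Lemma compm0 X Y Z (g : mor Y Z) : g \c (0 : mor X Y) = 0.
Proof. exact: lin_map0 (mcomp_linr g). Qed.

Lemma compNm X Y Z (g : mor Y Z) (f : mor X Y) : (- g) \c f = - (g \c f).
Proof. exact: (lin_mapN (mcomp_linl f)). Qed.

Lemma compmN X Y Z (g : mor Y Z) (f : mor X Y) : g \c (- f) = - (g \c f).
Proof. exact: (lin_mapN (mcomp_linr g)). Qed.

Lemma compBm X Y Z (g h : mor Y Z) (f : mor X Y) :
  (g - h) \c f = g \c f - h \c f.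
Proof. exact: (lin_mapB (mcomp_linl f)). Qed.

Lemma compmB X Y Z (g : mor Y Z) (f h : mor X Y) :
  g \c (f - h) = g \c f - g \c h.
Proof. exact: (lin_mapB (mcomp_linr g)). Qed.

Lemma compDm X Y Z (g h : mor Y Z) (f : mor X Y) :
  (g + h) \c f = g \c f + h \c f.
Proof. exact: (lin_mapD (mcomp_linl f)). Qed.

Lemma compmD X Y Z (g : mor Y Z) (f h : mor X Y) :
  g \c (f + h) = g \c f + g \c h.
Proof. exact: (lin_mapD (mcomp_linr g)). Qed.

Lemma is_iso_id X : is_iso (idmor X).
Proof. by exists (idmor X); split; rewrite mcomp1m. Qed.

Lemma is_iso_comp X Y Z (g : mor Y Z) (f : mor X Y) :
  is_iso g -> is_iso f -> is_iso (g \c f).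
Proof.
case=> g' [g'g gg'] [f' [f'f ff']]; exists (f' \c g'); split.
- by rewrite -mcompA (mcompA g') g'g mcomp1m.
- by rewrite -mcompA (mcompA f) ff' mcomp1m.
Qed.

Lemma iso_refl X : isomorphic X X.
Proof. by exists (idmor X); apply: is_iso_id. Qed.

Lemma iso_sym X Y : isomorphic X Y -> isomorphic Y X.
Proof. by case=> f [g [gf fg]]; exists g, f. Qed.

Lemma iso_trans X Y Z : isomorphic X Y -> isomorphic Y Z -> isomorphic X Z.
Proof. by case=> f fI [g gI]; exists (g \c f); apply: is_iso_comp. Qed.

Lemma is_zero_id X : idmor X = 0 -> is_zero X.
Proof.
by move=> X0; split=> Y f; [rewrite -(mcompm1 f)|rewrite -(mcomp1m f)];
  rewrite X0 ?compm0 ?comp0m.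
Qed.

Lemma is_zero_iso X Y : isomorphic X Y -> is_zero X -> is_zero Y.
Proof.
by case=> f [g [_ fg]] [X0 _]; apply: is_zero_id; rewrite -fg (X0 _ f) comp0m.
Qed.

Lemma zero_isomorphic X Y : is_zero X -> is_zero Y -> isomorphic X Y.
Proof.
by case=> X0 _ [Y0 _]; exists 0, 0; split;
  rewrite comp0m; [rewrite (X0 _ (idmor X))|rewrite (Y0 _ (idmor Y))].
Qed.

(** Monicity forces [i = 0], and then the identity and the zero map of [K] are
    two solutions of [i \c u = 0]. *)
Lemma mono_kernel0 K X Y (i : mor K X) (f : mor X Y) :
  is_mono f -> is_kernel i f -> is_zero K.
Proof.
move=> fM [fi iU]; have i0 : i = 0 by apply: fM; rewrite fi compm0.
have [|u [_ uU]] := iU K 0; first by rewrite compm0.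
by apply: is_zero_id; rewrite -(uU 0) ?compm0 // -(uU (idmor K)) ?i0 ?comp0m.
Qed.

Lemma epi_cokernel0 X Y Q (p : mor Y Q) (f : mor X Y) :
  is_epi f -> is_cokernel p f -> is_zero Q.
Proof.
move=> fE [pf pU]; have p0 : p = 0 by apply: fE; rewrite pf comp0m.
have [|u [_ uU]] := pU Q 0; first by rewrite comp0m.
by apply: is_zero_id; rewrite -(uU 0) ?comp0m // -(uU (idmor Q)) ?p0 ?compm0.
Qed.

End LinearCategory.

Section Functors.
Variables (k : fieldType) (C D : linCat k).

Lemma fmap0 (F : linFunctor C D) X Y : fmap F (0 : mor X Y) = 0.
Proof. exact: lin_map0 (@fmap_lin _ _ _ F X Y). Qed.

Lemma fmap_is_iso (F : linFunctor C D) X Y (f : mor X Y) :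
  is_iso f -> is_iso (fmap F f).
Proof.
case=> g [gf fg]; exists (fmap F g).
by split; rewrite -fmap_comp ?gf ?fg fmap_id.
Qed.

Lemma fmap_isomorphic (F : linFunctor C D) X Y :
  isomorphic X Y -> isomorphic (F X) (F Y).
Proof. by case=> f fI; exists (fmap F f); apply: fmap_is_iso. Qed.

Lemma is_zero_fmap (F : linFunctor C D) X : is_zero X -> is_zero (F X).
Proof.
by case=> X0 _; apply: is_zero_id; rewrite -fmap_id (X0 _ (idmor X)) fmap0.
Qed.

Lemma retraction_faithful (F : linFunctor C D) (G : linFunctor D C) :
  nat_isomorphic (comp_functor G F) (id_functor C) ->
  forall X Y (f g : mor X Y), fmap F f = fmap F g -> f = g.
Proof.
case=> a [nat aI] X Y f g eFfg.
have := nat _ _ f; have := nat _ _ g; rewrite /= eFfg => -> e.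
have [b [_ ab]] := aI X.
by rewrite -(mcompm1 g) -ab mcompA e -mcompA ab mcompm1.
Qed.

End Functors.

Section Equivalences.
Variables (k : fieldType) (C D : linCat k) (F : linFunctor C D).
Hypothesis F_equiv : is_equivalence F.

Lemma equiv_faithful X Y (f g : mor X Y) : fmap F f = fmap F g -> f = g.
Proof. by have [G [GF _]] := F_equiv; apply: (retraction_faithful GF). Qed.

Lemma equiv_full X Y (h : mor (F X) (F Y)) : exists f, fmap F f = h.
Proof.
have [G [GF FG]] := F_equiv; have [a [nat aI]] := GF.
have [b [ba ab]] := aI X; have [c [ca ac]] := aI Y.
(* The witness is the only [f] with [fmap G (fmap F f) = fmap G h]; as [G] is
   faithful too, it also satisfies [fmap F f = h]. *)
exists (a Y \c fmap G h \c b); apply: (retraction_faithful FG).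
have := nat _ _ (a Y \c fmap G h \c b); rewrite /= -[RHS]mcompA ba mcompm1 => e.
move: (a Y \c _ \c _) e => f e.
by rewrite -(mcomp1m (fmap G h)) -ca -mcompA -e mcompA ca mcomp1m.
Qed.

Lemma equiv_ess_surj (Y : D) : exists X, isomorphic (F X) Y.
Proof.
by have [G [_ [a [_ aI]]]] := F_equiv; exists (G Y), (a Y); apply: aI.
Qed.

Lemma equiv_reflects_iso X Y : isomorphic (F X) (F Y) -> isomorphic X Y.
Proof.
case=> f' [g' [gf fg]].
have [f Ff] := equiv_full f'; have [g Fg] := equiv_full g'.
by exists f, g; split; apply: equiv_faithful; rewrite fmap_comp Ff Fg fmap_id.
Qed.

End Equivalences.

Section FullSubcategories.
Variables (k : fieldType) (C : linCat k) (P : C -> Prop).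

Lemma full_sub_zero (X : full_sub P) :
  is_zero X <-> is_zero (sval X).
Proof.
by split=> [[/(_ _ (idmor X)) X0 _]|[X0 _]]; apply: is_zero_id; apply: X0.
Qed.

Lemma full_sub_is_iso (X Y : full_sub P) (f : mor X Y) :
  is_iso (f : @mor k C (sval X) (sval Y)) -> is_iso f.
Proof. by case=> g gI; exists g. Qed.

(** The hypothesis that [F] reflects membership is what makes the quasi-inverse
    restrict as well. *)
Lemma restrict_equivalence (D : linCat k) (Q : D -> Prop) (F : linFunctor C D)
    (hF : forall X, P X -> Q (F X)) :
  strict_sub Q -> (forall X, Q (F X) -> P X) ->
  is_equivalence F -> is_equivalence (restrict_functor hF).
Proof.
move=> Qs QP [G [[a [a_nat aI]] [b [b_nat bI]]]].
have hG Y : Q Y -> P (G Y).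
  move=> QY; apply: QP; apply: Qs QY; apply: iso_sym.
  by exists (b Y); apply: bI.
exists (restrict_functor hG); split.
- exists (fun X : full_sub P => a (sval X)); split=> [X Y f|X].
  + exact: a_nat.
  + exact/full_sub_is_iso/aI.
- exists (fun Y : full_sub Q => b (sval Y)); split=> [X Y f|X].
  + exact: b_nat.
  + by have [g gI] := bI (sval X); exists g.
Qed.

End FullSubcategories.

(** * Triangles *)

Section TriangulatedCategory.
Variables (k : fieldType) (T : triCat k).
Implicit Types X Y Z W : T.
Notation S := (sh T).

Lemma sh_equiv : is_equivalence S.
Proof. by exists (shV T); split; [apply: shK|apply: shVK]. Qed.

Lemma sh_faithful X Y (f g : mor X Y) : fmap S f = fmap S g -> f = g.
Proof. exact: equiv_faithful sh_equiv _ _ _ _. Qed.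

Lemma sh_full X Y (h : mor (S X) (S Y)) : exists f, fmap S f = h.
Proof. exact: equiv_full sh_equiv _ _ _. Qed.

Lemma sh_reflects_iso X Y : isomorphic (S X) (S Y) -> isomorphic X Y.
Proof. exact: equiv_reflects_iso sh_equiv _ _. Qed.

Lemma sh_reflects_zero X : is_zero (S X) -> is_zero X.
Proof.
case=> SX0 _; apply: is_zero_id; apply: sh_faithful.
by rewrite fmap_id (SX0 _ (idmor _)) fmap0.
Qed.

(** Exactness of [Hom(W, -)] at the middle term: compare with the triangle
    [W -> 0 -> Sigma W], so that the third map of the morphism of triangles is
    the suspension of the lift. *)
Lemma dist_lift X Y Z (f : mor X Y) (g : mor Y Z) (h : mor Z (S X)) W
    (u : mor W Y) : dist f g h -> g \c u = 0 -> exists v, f \c v = u.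
Proof.
move=> fgh gu; have [O [_ dW]] := tr1_id W.
have := tr3 (iffLR (tr2 _ _ _) dW) (iffLR (tr2 _ _ _) fgh) (u := u) (v := 0).
rewrite comp0m gu => /(_ erefl) [w [_]].
have [v <-] := sh_full w.
rewrite fmap_id compmN mcompm1 compNm -fmap_comp => /oppr_inj e.
by exists v; rewrite -(sh_faithful e).
Qed.

Lemma dist_zero_id X O : is_zero O ->
  dist (0 : mor O X) (idmor X) (0 : mor X (S O)).
Proof.
move=> O0; apply/tr2; rewrite fmap0 oppr0; have [Z [Z0 dX]] := tr1_id X.
have [w wI] := zero_isomorphic Z0 (is_zero_fmap S O0).
apply: (tr1_iso _ _ wI _ _ _ dX); try exact: is_iso_id.
- by [].
- by rewrite compm0 comp0m.
- by rewrite compm0 comp0m.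
Qed.

(** Exactness of [Hom(-, W)] at the middle term, by comparison with the triangle
    [0 -> W -> W]. *)
Lemma dist_extend X Y Z (f : mor X Y) (g : mor Y Z) (h : mor Z (S X)) W
    (u : mor Y W) : dist f g h -> u \c f = 0 -> exists v, v \c g = u.
Proof.
move=> fgh uf; have [[O O0] _] := tri_additive T.
have := tr3 fgh (dist_zero_id W O0) (u := 0) (v := u).
by rewrite comp0m uf => /(_ erefl) [v [e _]]; exists v; rewrite e mcomp1m.
Qed.

Lemma dist_comp0 X Y Z (f : mor X Y) (g : mor Y Z) (h : mor Z (S X)) :
  dist f g h -> g \c f = 0.
Proof.
move=> fgh; have [O [_ dX]] := tr1_id X.
have := tr3 dX fgh (u := idmor X) (v := f).
by rewrite !mcompm1 => /(_ erefl) [w [<- _]]; rewrite compm0.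
Qed.

(** Exactness of [Hom(W, -)] one place to the left of [dist_lift], phrased after
    suspension because only [sh] occurs in a triangle. *)
Lemma dist_lift_sh X Y Z (f : mor X Y) (g : mor Y Z) (h : mor Z (S X)) W
    (u : mor W X) :
  dist f g h -> f \c u = 0 -> exists v : mor (S W) Z, h \c v = fmap S u.
Proof.
move=> /tr2/tr2 ghf fu; apply: (dist_lift ghf).
by rewrite compNm -fmap_comp fu fmap0 oppr0.
Qed.

(** Rotating three times sends [(a, p, d)] to [(-Sigma a, -Sigma p, -Sigma d)],
    and rotation is an equivalence of conditions: so any triangle whose
    vertices are written as suspensions is the rotation of one that is
    desuspended, signs being absorbed in the choice of the maps. *)
Lemma dist_desuspend A X B (a : mor A (S X)) (p : mor (S X) B)
    (d : mor B (S A)) :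
  dist a p d -> exists A' B' (a' : mor A' X) (p' : mor X B')
    (d' : mor B' (S A')),
    [/\ isomorphic (S A') A, isomorphic (S B') B & dist a' p' d'].
Proof.
move=> apd.
have [A' [u uI]] := equiv_ess_surj sh_equiv A.
have [B' [v vI]] := equiv_ess_surj sh_equiv B.
have [u' [u'u uu']] := uI; have [v' [v'v vv']] := vI.
have [a' ea] := sh_full (- (a \c u)).
have [p' ep] := sh_full (- (v' \c p)).
have [d' ed] := sh_full (- (fmap S u' \c d \c v)).
exists A', B', a', p', d'; split; [by exists u|by exists v|].
apply/tr2/tr2/tr2; rewrite ea ep ed !opprK.
have u'I : is_iso u' by exists u.
have v'I : is_iso v' by exists v.
apply: (tr1_iso u'I (is_iso_id _) v'I _ _ _ apd).
- by rewrite mcomp1m -mcompA uu' mcompm1.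
- by rewrite mcompm1.
- by rewrite -mcompA vv' mcompm1.
Qed.

End TriangulatedCategory.

Section Triangles.
Variables (k : fieldType) (T : triCat k).
Implicit Types A B X Y Z W : T.
Notation S := (sh T).

(** Membership in the halves of a t-structure depends on the vertices of a
    triangle only, which lets its maps be forgotten. *)
Definition triangle X Y Z : Prop :=
  exists (f : mor X Y) (g : mor Y Z) (h : mor Z (S X)), dist f g h.

Definition hom0 X Y : Prop := forall f : mor X Y, f = 0.

Lemma is_zero_hom0 X : is_zero X <-> hom0 X X.
Proof. by split=> [[+ _] f|X0]; [apply|apply: is_zero_id]. Qed.

Lemma hom0_iso X X' Y Y' :
  isomorphic X X' -> isomorphic Y Y' -> hom0 X Y -> hom0 X' Y'.
Proof.
case=> u [u' [_ uu']] [v [v' [_ vv']]] XY0 f.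
rewrite -(mcomp1m f) -vv' -(mcompm1 (_ \c f)) -uu' mcompA.
by rewrite -(mcompA v) -(mcompA v) (XY0 (_ \c _)) compm0 comp0m.
Qed.

Lemma hom0_sh X Y : hom0 (S X) (S Y) <-> hom0 X Y.
Proof.
split=> XY0 f; first by apply: sh_faithful; rewrite (XY0 (fmap _ _)) fmap0.
by have [g <-] := sh_full f; rewrite (XY0 g) fmap0.
Qed.

Lemma hom0_from_ext X Y Z W :
  triangle X Y Z -> hom0 X W -> hom0 Z W -> hom0 Y W.
Proof.
case=> f [g [h fgh]] XW0 ZW0 u.
by have [v <-] := dist_extend fgh (XW0 (u \c f)); rewrite (ZW0 v) comp0m.
Qed.

Lemma hom0_to_ext X Y Z W :
  triangle X Y Z -> hom0 W X -> hom0 W Z -> hom0 W Y.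
Proof.
case=> f [g [h fgh]] WX0 WZ0 u.
by have [v <-] := dist_lift fgh (WZ0 (g \c u)); rewrite (WX0 v) compm0.
Qed.

Lemma triangle_iso X Y Z X' Y' Z' :
  isomorphic X X' -> isomorphic Y Y' -> isomorphic Z Z' ->
  triangle X Y Z -> triangle X' Y' Z'.
Proof.
case=> u uI [v vI] [w wI] [f [g [h fgh]]].
have [u' [u'u uu']] := uI; have [v' [v'v vv']] := vI.
have [w' [w'w ww']] := wI.
exists (v \c f \c u'), (w \c g \c v'), (fmap S u \c h \c w').
apply: (tr1_iso uI vI wI _ _ _ fgh).
- by rewrite -mcompA u'u mcompm1.
- by rewrite -mcompA v'v mcompm1.
- by rewrite -mcompA w'w mcompm1.
Qed.

Lemma triangle_rot X Y Z : triangle X Y Z -> triangle Y Z (S X).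
Proof.
by case=> f [g [h /tr2 fgh]]; exists g, h, (- fmap S f).
Qed.

Lemma triangle_suspend X Y Z : triangle X Y Z -> triangle (S X) (S Y) (S Z).
Proof. by move=> XYZ; do 3!apply: triangle_rot. Qed.

Lemma triangle_desuspend A X B : triangle A (S X) B ->
  exists A' B',
    [/\ isomorphic (S A') A, isomorphic (S B') B & triangle A' X B'].
Proof.
case=> a [p [d apd]].
have [A' [B' [a' [p' [d' [A'A B'B apd']]]]]] := dist_desuspend apd.
by exists A', B'; split=> //; exists a', p', d'.
Qed.

Lemma dist_desc_inj X Y Z (f : mor X Y) (g : mor Y Z) (h : mor Z (S X))
    W (v w : mor Z W) :
  dist f g h -> hom0 (S X) W -> v \c g = w \c g -> v = w.
Proof.
move=> /tr2 ghf SXW0 evw; apply/eqP; rewrite -subr_eq0; apply/eqP.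
have [|u <-] := dist_extend (u := v - w) ghf; first by rewrite compBm evw subrr.
by rewrite (SXW0 u) comp0m.
Qed.

Lemma dist_lift_inj X Y Z (f : mor X Y) (g : mor Y Z) (h : mor Z (S X))
    W (v w : mor W X) :
  dist f g h -> hom0 (S W) Z -> f \c v = f \c w -> v = w.
Proof.
move=> fgh SWZ0 evw; apply/eqP; rewrite -subr_eq0; apply/eqP.
have [|u hu] := dist_lift_sh (u := v - w) fgh.
  by rewrite compmB evw subrr.
by apply: sh_faithful; rewrite -hu (SWZ0 u) compm0 fmap0.
Qed.

(** A zero third vertex makes [f] split epi by [dist_lift]; then the defect of
    the section from being a left inverse is killed by [f], hence comes from
    the third vertex. *)
Lemma dist_zero_right X Y Z (f : mor X Y) (g : mor Y Z) (h : mor Z (S X)) :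
  dist f g h -> is_zero Z -> is_iso f.
Proof.
move=> fgh [Z0 Z0'].
have [s fs] : exists s, f \c s = idmor Y by apply: (dist_lift fgh (Z0' _ _)).
exists s; split=> //; apply/eqP; rewrite -subr_eq0; apply/eqP.
have [|v hv] := dist_lift_sh (u := s \c f - idmor X) fgh.
  by rewrite compmB mcompA fs mcomp1m mcompm1 subrr.
by apply: sh_faithful; rewrite -hv (Z0' _ v) compm0 fmap0.
Qed.

Lemma dist_zero_left X Y Z (f : mor X Y) (g : mor Y Z) (h : mor Z (S X)) :
  dist f g h -> is_zero X -> is_iso g.
Proof.
by move=> /tr2 ghf X0; apply: (dist_zero_right ghf (is_zero_fmap S X0)).
Qed.

Lemma triangle_zero_right X Y Z :
  triangle X Y Z -> is_zero Z -> isomorphic X Y.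
Proof. by case=> f [g [h fgh]] Z0; exists f; apply: (dist_zero_right fgh). Qed.

Lemma triangle_zero_left X Y Z :
  triangle X Y Z -> is_zero X -> isomorphic Y Z.
Proof. by case=> f [g [h fgh]] X0; exists g; apply: (dist_zero_left fgh). Qed.

End Triangles.

(** * Shift-compatible families of subcategories *)

(** Every statement about degrees below is invariant under the shift, so that
    the case of degree 0 spreads in both directions. *)
Lemma int_shift_ind (P : int -> Prop) :
  P 0 -> (forall n, P n <-> P (n + 1)) -> forall n, P n.
Proof.
move=> P0 Pstep; elim/int_rec=> [//|n Pn|n Pn].
- by rewrite -addn1 PoszD -Pstep.
- by apply/Pstep; rewrite -addn1 PoszD opprD addrNK.
Qed.

Section ShiftFamilies.
Variables (k : fieldType) (T : triCat k).
Implicit Types X Y Z W : T.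
Notation S := (sh T).

(** The common feature of [n |-> D^{<= n}], [n |-> D^{>= n}] and their images
    under an exact functor: such a family is determined by any one of its
    members, which is how facts known in one degree are moved to all. *)
Definition shift_family (P : int -> T -> Prop) : Prop :=
  (forall n, strict_sub (P n)) /\ forall n X, P n (S X) <-> P (n + 1) X.

Lemma iso_sh_surj X : exists X', isomorphic (S X') X.
Proof. exact: equiv_ess_surj (sh_equiv T) _. Qed.

Lemma shift_family_incl (P Q : int -> T -> Prop) a b :
  shift_family P -> shift_family Q ->
  (forall X, P a X -> Q b X) -> forall j X, P (a + j) X -> Q (b + j) X.
Proof.
move=> [Ps Psh] [Qs Qsh] PQ; elim/int_shift_ind=> [|j]; first by rewrite !addr0.
split=> PQj X.
- by rewrite !addrA -Psh -Qsh; apply: PQj.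
- move=> PX; have [X' X'X] := iso_sh_surj X; apply: (Qs _ _ _ X'X); apply/Qsh.
  rewrite -addrA; apply: PQj; rewrite addrA; apply/Psh.
  exact: Ps (iso_sym X'X) PX.
Qed.

Lemma shift_family_eq (P Q : int -> T -> Prop) a :
  shift_family P -> shift_family Q -> (forall X, P a X <-> Q a X) ->
  forall n X, P n X <-> Q n X.
Proof.
move=> PF QF PQ n X; rewrite -(subrK a n) addrC.
by split; [apply: (shift_family_incl PF QF)|apply: (shift_family_incl QF PF)];
  move=> Y /PQ.
Qed.

Lemma sh_shiftz n X : isomorphic (S (shiftz n X)) (shiftz (n + 1) X).
Proof.
have shVK' Y : isomorphic (S (shV T Y)) Y.
  by have [a [_ aI]] := shVK T; exists (a Y); apply: aI.
case: n => [n|[|n]].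
- by rewrite -PoszD addn1; apply: iso_refl.
- exact: shVK'.
- have -> : Negz n.+1 + 1 = Negz n by rewrite !NegzE -addn1 PoszD opprD addrNK.
  exact: shVK'.
Qed.

Lemma shift_sub_strict n (P : T -> Prop) : strict_sub (shift_sub n P).
Proof.
move=> X Y XY [Z [PZ XZ]]; exists Z; split=> //.
exact: iso_trans (iso_sym XY) XZ.
Qed.

Lemma shift_sub_sh n (P : T -> Prop) X :
  shift_sub (n + 1) P (S X) <-> shift_sub n P X.
Proof.
split=> -[Y [PY XY]]; exists Y; split=> //.
- by apply: sh_reflects_iso; apply: iso_trans XY (iso_sym (sh_shiftz n Y)).
- exact: iso_trans (fmap_isomorphic S XY) (sh_shiftz n Y).
Qed.

Lemma tle_family (t : tPair T) : shift_family (tle t).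
Proof.
split=> [n|n X]; first exact: shift_sub_strict.
have {1}-> : n = n + 1 - 1 by rewrite addrK.
by rewrite /tle opprB addrC shift_sub_sh.
Qed.

Lemma tge_family (t : tPair T) : shift_family (tge t).
Proof.
split=> [n|n X]; first exact: shift_sub_strict.
have {1}-> : n = n + 1 - 1 by rewrite addrK.
by rewrite /tge opprB addrC shift_sub_sh.
Qed.

Lemma shift_sub0 (P : T -> Prop) X :
  strict_sub P -> shift_sub 0 P X <-> P X.
Proof.
move=> Ps; split=> [[Y [PY XY]]|PX]; first exact: Ps (iso_sym XY) PY.
by exists X; split=> //; apply: iso_refl.
Qed.

End ShiftFamilies.

(** * t-structures in all degrees *)

Section TStructure.
Variables (k : fieldType) (T : triCat k) (t : tPair T).
Hypothesis ht : is_tstructure t.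
Implicit Types A B X Y Z W : T.
Notation S := (sh T).

Lemma tle_strict n : strict_sub (tle t n).
Proof. exact: (tle_family t).1. Qed.

Lemma tge_strict n : strict_sub (tge t n).
Proof. exact: (tge_family t).1. Qed.

Lemma tle_sh n X : tle t n (S X) <-> tle t (n + 1) X.
Proof. exact: (tle_family t).2. Qed.

Lemma tge_sh n X : tge t n (S X) <-> tge t (n + 1) X.
Proof. exact: (tge_family t).2. Qed.

Lemma tle0 X : tle t 0 X <-> aisle t X.
Proof. by rewrite /tle oppr0; apply: shift_sub0; apply: ts_strict_aisle. Qed.

Lemma tge1 X : tge t 1 X <-> coaisle t X.
Proof. by rewrite /tge subrr; apply: shift_sub0; apply: ts_strict_coaisle. Qed.

Lemma tle_succ n X : tle t n X -> tle t (n + 1) X.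
Proof.
have base Y : tle t 0 Y -> tle t 1 Y.
  by move=> /tle0 Y0; apply/(tle_sh 0)/tle0; apply: ts_aisle_shift.
have := @shift_family_incl _ _ _ _ _ _ (tle_family t) (tle_family t) base n X.
by rewrite add0r addrC.
Qed.

Lemma tge_pred n X : tge t (n + 1) X -> tge t n X.
Proof.
have base Y : tge t 1 Y -> tge t 0 Y.
  by move=> /tge1; rewrite /tge subr0; apply: ts_coaisle_shift.
have := @shift_family_incl _ _ _ _ _ _ (tge_family t) (tge_family t) base n X.
by rewrite add0r addrC.
Qed.

Lemma tle_mono m n X : m <= n -> tle t m X -> tle t n X.
Proof.
rewrite -subr_ge0 -{2}(subrK m n) => + Xm; case: (n - m) => // j _.
elim: j => [|j IH]; first by rewrite add0r.
by rewrite -addn1 PoszD addrAC; apply: tle_succ.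
Qed.

Lemma tge_mono m n X : m <= n -> tge t n X -> tge t m X.
Proof.
rewrite -subr_ge0 -{2}(subrK m n); case: (n - m) => // j _.
elim: j => [|j IH]; first by rewrite add0r.
by rewrite -addn1 PoszD addrAC => /tge_pred/IH.
Qed.

Lemma t_orth n X Y : tle t n X -> tge t (n + 1) Y -> hom0 X Y.
Proof.
elim/int_shift_ind: n X Y => [X Y /tle0 X0 /tge1 Y1 f|n].
  exact: (ts_orth ht).
split=> orth X Y Xn Yn.
- by apply/hom0_sh; apply: orth; [apply/tle_sh|apply/tge_sh].
- have [X' X'X] := iso_sh_surj X; have [Y' Y'Y] := iso_sh_surj Y.
  apply: (hom0_iso X'X Y'Y); apply/hom0_sh; apply: orth.
  + by apply/tle_sh; apply: tle_strict Xn; apply: iso_sym.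
  + by apply/tge_sh; apply: tge_strict Yn; apply: iso_sym.
Qed.

(** Truncation in degree [n + 1] of [X] is the desuspension of the truncation in
    degree [n] of [Sigma X]. *)
Lemma t_trunc n X :
  exists A B, [/\ tle t n A, tge t (n + 1) B & triangle A X B].
Proof.
elim/int_shift_ind: n X => [X|n].
  have [A [B [a [p [d [A0 B1 apd]]]]]] := ts_triangle ht X.
  by exists A, B; split; [apply/tle0|apply/tge1|exists a, p, d].
split=> trunc X.
- have [A [B [An Bn]]] := trunc (S X).
  move=> /triangle_desuspend[A' [B' [A'A B'B tri]]].
  exists A', B'; split=> //.
  + by apply/tle_sh; apply: tle_strict An; apply: iso_sym.
  + by apply/tge_sh; apply: tge_strict Bn; apply: iso_sym.
- have [X' X'X] := iso_sh_surj X; have [A [B [An Bn tri]]] := trunc X'.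
  exists (S A), (S B); split; [exact/tle_sh|exact/tge_sh|].
  exact: triangle_iso (iso_refl _) X'X (iso_refl _) (triangle_suspend tri).
Qed.

(** Each half of a t-structure is the orthogonal of the other: if the map
    [X -> B] of the truncation triangle vanishes then the identity of [B]
    factors through [Sigma A], and [Hom(Sigma A, B) = 0]. *)
Lemma tleP n X : tle t n X <-> forall Y, tge t (n + 1) Y -> hom0 X Y.
Proof.
split=> [Xn Y|X0]; first exact: t_orth.
have [A [B [An Bn tri]]] := t_trunc n X.
have [a [p [d apd]]] := tri.
suff B0 : is_zero B by apply: tle_strict An; apply: triangle_zero_right tri B0.
apply: is_zero_id.
have [|v <-] := dist_extend (u := idmor B) (iffLR (tr2 _ _ _) apd).
  by rewrite mcomp1m; apply: X0 Bn p.
suff SAB0 : hom0 (S A) B by rewrite (SAB0 v) comp0m.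
by apply: t_orth Bn; apply/tle_sh/tle_succ.
Qed.

Lemma tgeP n Y : tge t (n + 1) Y <-> forall X, tle t n X -> hom0 X Y.
Proof.
split=> [Yn X Xn|Y0]; first exact: t_orth Yn.
have [A [B [An Bn tri]]] := t_trunc n Y.
have [a [p [d apd]]] := tri.
suff A0 : is_zero A.
  by apply: tge_strict Bn; apply: iso_sym; apply: triangle_zero_left tri A0.
apply: sh_reflects_zero; apply: is_zero_id.
have [|v] := dist_lift_sh (u := idmor A) apd.
  by rewrite mcompm1; apply: Y0 An a.
rewrite fmap_id => <-.
suff SAB0 : hom0 (S A) B by rewrite (SAB0 v) compm0.
by apply: t_orth Bn; apply/tle_sh/tle_succ.
Qed.

Lemma tge_perp n Y : tge t n Y <-> forall X, tle t (n - 1) X -> hom0 X Y.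
Proof. by rewrite -tgeP subrK. Qed.

Lemma tle_ext n X Y Z : triangle X Y Z -> tle t n X -> tle t n Z -> tle t n Y.
Proof.
move=> tri Xn Zn; apply/tleP => W Wn.
by apply: hom0_from_ext tri _ _; apply: t_orth Wn.
Qed.

Lemma tge_ext n X Y Z : triangle X Y Z -> tge t n X -> tge t n Z -> tge t n Y.
Proof.
move=> tri /tge_perp Xn /tge_perp Zn; apply/tge_perp => W Wn.
by apply: hom0_to_ext tri _ _; [apply: Xn|apply: Zn].
Qed.

(** The shift of degree on [X] reflects that the cone is an extension of
    [Sigma X] by [Y]. *)
Lemma tle_cone n X Y Z :
  triangle X Y Z -> tle t (n + 1) X -> tle t n Y -> tle t n Z.
Proof.
by move=> tri /tle_sh Xn Yn; apply: tle_ext (triangle_rot tri) _ _.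
Qed.

Lemma tge_cocone n X Y Z :
  triangle X Y Z -> tge t (n + 1) Y -> tge t n Z -> tge t (n + 1) X.
Proof.
move=> tri /tge_sh Yn Zn; apply/tge_sh.
by apply: tge_ext (triangle_rot (triangle_rot tri)) _ _.
Qed.

Lemma zero_of_gap n X : tle t n X -> tge t (n + 1) X -> is_zero X.
Proof. by move=> Xl Xg; apply/is_zero_hom0; apply: t_orth Xl Xg. Qed.

Lemma in_heart_iso X Y : isomorphic X Y -> in_heart t X -> in_heart t Y.
Proof.
by move=> XY [Xl Xg]; split; [apply: tle_strict Xl|apply: tge_strict Xg].
Qed.

End TStructure.

(** * The heart is abelian *)

Section HeartAbelian.
Variables (k : fieldType) (T : triCat k) (t : tPair T).
Hypothesis ht : is_tstructure t.
Notation S := (sh T).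
Notation H := (heart t).

Lemma hom0_shift_heart (X Y : H) : hom0 (S (sval X)) (sval Y).
Proof.
case: X Y => X [Xl Xg] [Y [Yl Yg]] /=; apply: (t_orth ht (n := -1)) Yg.
by apply/tle_sh.
Qed.

Lemma hom0_shift2_heart (X Y : H) : hom0 (S (S (sval X))) (sval Y).
Proof.
case: X Y => X [Xl Xg] [Y [Yl Yg]] /=; apply: (t_orth ht (n := -1)) Yg.
by apply/tle_sh/tle_succ/tle_sh.
Qed.

(** A distinguished triangle with its three vertices in the heart is a short
    exact sequence: lifts exist by the long exact sequences, and are unique
    because there are no nonzero maps of negative degree in the heart. *)
Lemma short_exact_kernel (X Y Z : H) (f : mor X Y) (g : mor Y Z)
    (h : mor (sval Z) (S (sval X))) :
  @dist k T _ _ _ f g h -> is_kernel f g.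
Proof.
move=> fgh; split=> [|W u gu]; first exact: dist_comp0 fgh.
have [v fv] := dist_lift fgh gu; exists v; split=> // w fw.
by apply: (dist_lift_inj fgh (@hom0_shift_heart W Z)); rewrite fv.
Qed.

Lemma short_exact_cokernel (X Y Z : H) (f : mor X Y) (g : mor Y Z)
    (h : mor (sval Z) (S (sval X))) :
  @dist k T _ _ _ f g h -> is_cokernel g f.
Proof.
move=> fgh; split=> [|W u uf]; first exact: dist_comp0 fgh.
have [v vg] := dist_extend fgh uf; exists v; split=> // w wg.
by apply: (dist_desc_inj fgh (@hom0_shift_heart X W)); rewrite vg.
Qed.

(** The cone [C] of a map of the heart lives in degrees [-1] and [0].  The two
    truncation pieces [Sigma K] and [Q] of [C] provide its kernel and its
    cokernel. *)
Lemma heart_cone_trunc (X Y : H) (f : mor X Y) :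
  exists (C : T) (g : mor (sval Y) C) (h : mor C (S (sval X))) (K Q : H)
    (a : mor (S (sval K)) C) (p : mor C (sval Q))
    (d : mor (sval Q) (S (S (sval K)))),
    @dist k T _ _ _ f g h /\ dist a p d.
Proof.
case: X Y f => X [Xl Xg] [Y [Yl Yg]] /= f.
have [C [g [h fgh]]] := @tr1_cone k T X Y f.
have XYC : triangle X Y C by exists f, g, h.
have Cl : tle t 0 C by apply: (tle_cone ht XYC) => //; apply: tle_mono Xl.
have Cg : tge t (-1) C.
  apply: (tge_ext ht (triangle_rot XYC)); first exact: tge_mono Yg.
  by apply/tge_sh.
have [A [Q [Al Qg ACQ]]] := t_trunc ht (-1) C; rewrite addNr in Qg.
have Ql : tle t 0 Q by apply: (tle_cone ht ACQ) => //; apply: tle_mono Al.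
have Ag : tge t (-1) A.
  by apply: (@tge_cocone _ _ _ ht (-2) _ _ _ ACQ) => //; apply: tge_mono Qg.
have [K KA] := iso_sh_surj A.
have Kl : tle t 0 K.
  by apply/(@tle_sh _ _ t (-1)); apply: tle_strict Al; apply: iso_sym.
have Kg : tge t 0 K.
  by apply/(@tge_sh _ _ t (-1)); apply: tge_strict Ag; apply: iso_sym.
have [a [p [d apd]]] := triangle_iso (iso_sym KA) (iso_refl _) (iso_refl _) ACQ.
by exists C, g, h, (exist _ K (conj Kl Kg)), (exist _ Q (conj Ql Qg)), a, p, d.
Qed.

Section KernelCokernel.
Variables (X Y : H) (f : mor X Y).
Variables (C : T) (g : mor (sval Y) C) (h : mor C (S (sval X))).
Variables (K Q : H) (a : mor (S (sval K)) C) (p : mor C (sval Q)).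
Variable (d : mor (sval Q) (S (S (sval K)))).
Hypothesis (fgh : @dist k T _ _ _ f g h) (apd : dist a p d).

Lemma cone_trunc_cokernel : is_cokernel (p \c g : mor Y Q) f.
Proof.
split=> [|W u uf] /=; first by rewrite -mcompA (dist_comp0 fgh) compm0.
have [v vg] := dist_extend fgh uf.
have [w wp] := dist_extend apd (@hom0_shift_heart K W (v \c a)).
exists w; split=> [|w' ew'] /=; first by rewrite mcompA wp.
apply: (dist_desc_inj apd (@hom0_shift2_heart K W)).
apply: (dist_desc_inj fgh (@hom0_shift_heart X W)).
by rewrite -!mcompA ew' mcompA wp.
Qed.

Lemma cone_trunc_kernel (i : mor K X) : fmap S i = h \c a -> is_kernel i f.
Proof.
move=> Si; split=> [|W u fu] /=.
  apply: sh_faithful; rewrite fmap_comp Si fmap0 mcompA.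
  have /tr2/tr2 hfg := fgh.
  suff -> : fmap S f \c h = 0 by rewrite comp0m.
  by apply: oppr_inj; rewrite -compNm oppr0; apply: dist_comp0 hfg.
have [v hv] := dist_lift_sh fgh fu.
have [w' aw'] := dist_lift apd (@hom0_shift_heart W Q (p \c v)).
have [w ew] := sh_full w'.
exists w; split=> [|w2 ew2] /=.
  by apply: sh_faithful; rewrite fmap_comp Si -mcompA ew aw' hv.
apply: sh_faithful; apply: (dist_lift_inj apd (@hom0_shift2_heart W Q)).
apply: (dist_lift_inj (iffLR (tr2 _ _ _) (iffLR (tr2 _ _ _) fgh))).
  by apply/hom0_sh; apply: hom0_shift_heart.
by rewrite ew aw' hv mcompA -Si -fmap_comp ew2.
Qed.

End KernelCokernel.

Lemma heart_kernel_cokernel (X Y : H) (f : mor X Y) :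
  (exists (K : H) (i : mor K X), is_kernel i f) /\
  (exists (Q : H) (p : mor Y Q), is_cokernel p f).
Proof.
have [C [g [h [K [Q [a [p [d [fgh apd]]]]]]]]] := heart_cone_trunc f.
have [i Si] := sh_full (h \c a).
split; first by exists K, i; apply: (cone_trunc_kernel fgh apd).
by exists Q, (p \c g); apply: (cone_trunc_cokernel fgh apd).
Qed.

Lemma heart_zero : exists Z : H, is_zero Z.
Proof.
have [[Z Z0] _] := tri_additive T; have [ZY YZ] := Z0.
have hZ : in_heart t Z.
  by split; [apply/(tleP ht) => Y _ f|apply/(tge_perp ht) => Y _ f].
by exists (exist _ Z hZ); apply/full_sub_zero.
Qed.

(** For a monomorphism the piece [Sigma K] of the cone vanishes, so that the
    cone is [Q] and the triangle on [f] is a short exact sequence. *)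
Lemma heart_mono_kernel (X Y : H) (f : mor X Y) :
  is_mono f -> exists (Z : H) (g : mor Y Z), is_kernel f g.
Proof.
have [C [g [h [K [Q [a [p [d [fgh apd]]]]]]]]] := heart_cone_trunc f.
have [i Si] := sh_full (h \c a).
move=> /mono_kernel0 /(_ (cone_trunc_kernel fgh apd Si)) /full_sub_zero K0.
have [p' [p'p pp']] := dist_zero_left apd (is_zero_fmap S K0).
exists Q, (p \c g); apply: (short_exact_kernel (h := h \c p')).
apply: (tr1_iso (w := p) (is_iso_id _) (is_iso_id _) _ _ _ _ fgh).
- by exists p'; split.
- by rewrite mcompm1 mcomp1m.
- by rewrite mcompm1.
- by rewrite fmap_id mcomp1m -mcompA p'p mcompm1.
Qed.

(** For an epimorphism the piece [Q] of the cone vanishes; the triangle, rotated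
    back once, is the short exact sequence [K -> X -> Y]. *)
Lemma heart_epi_cokernel (X Y : H) (f : mor X Y) :
  is_epi f -> exists (Z : H) (g : mor Z X), is_cokernel f g.
Proof.
have [C [g [h [K [Q [a [p [d [fgh apd]]]]]]]]] := heart_cone_trunc f.
(* The sign compensates the one that rotation puts on the third map. *)
have [i Si] := sh_full (- (h \c a)).
move=> /epi_cokernel0 /(_ (cone_trunc_cokernel fgh apd)) /full_sub_zero Q0.
have [a' [a'a aa']] := dist_zero_right apd Q0.
exists K, i; apply: (short_exact_cokernel (h := a' \c g)).
apply/tr2; rewrite Si opprK.
apply: (tr1_iso (w := a') (is_iso_id _) (is_iso_id _) _ _ _ _ fgh).
- by exists a; split.
- by rewrite mcompm1 mcomp1m.
- by rewrite mcompm1.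
- by rewrite fmap_id mcomp1m -mcompA aa' mcompm1.
Qed.

Lemma heart_biproduct (X Y : H) : exists (B : H) (i1 : mor X B) (i2 : mor Y B)
  (p1 : mor B X) (p2 : mor B Y), is_biproduct i1 i2 p1 p2.
Proof.
case: X Y => X [Xl Xg] [Y [Yl Yg]].
have [B [i1 [i2 [p1 [p2 [e1 e2 e]]]]]] := (tri_additive T).2 X Y.
have hB : in_heart t B; last by exists (exist _ B hB), i1, i2, p1, p2.
split.
- apply/(tleP ht) => W Wg f; rewrite -(mcompm1 f) -e compmD !mcompA.
  rewrite (t_orth ht Xl Wg (f \c i1)) (t_orth ht Yl Wg (f \c i2)).
  by rewrite !comp0m addr0.
- move: Xg Yg => /(tge_perp ht) Xg /(tge_perp ht) Yg.
  apply/(tge_perp ht) => W Wl f; rewrite -(mcomp1m f) -e compDm -!mcompA.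
  by rewrite (Xg W Wl (p1 \c f)) (Yg W Wl (p2 \c f)) !compm0 addr0.
Qed.

Theorem heart_abelian : is_abelian H.
Proof.
split.
- by split; [apply: heart_zero|apply: heart_biproduct].
- by move=> X Y f; have [] := heart_kernel_cokernel f.
- by move=> X Y f; have [] := heart_kernel_cokernel f.
- exact: heart_mono_kernel.
- exact: heart_epi_cokernel.
Qed.

End HeartAbelian.

(** * Tensor products and t-structures *)

Section ExactFunctors.
Variables (k : fieldType) (T1 T2 : triCat k) (F : linFunctor T1 T2).
Variable theta : forall X : T1, mor (F (sh T1 X)) (sh T2 (F X)).
Hypothesis F_exact : is_exact_functor theta.

Lemma exact_sh_isomorphic X : isomorphic (F (sh T1 X)) (sh T2 (F X)).
Proof. by exists (theta X); apply: (ex_nat_iso F_exact).2. Qed.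

Lemma exact_triangle X Y Z : triangle X Y Z -> triangle (F X) (F Y) (F Z).
Proof.
case=> f [g [h fgh]]; exists (fmap F f), (fmap F g), (theta X \c fmap F h).
exact: (ex_dist F_exact).
Qed.

End ExactFunctors.

Section Tensor.
Variables (k : fieldType) (T : mtCat k).
Implicit Types A B X Y Z : T.
Notation S := (sh T).
Notation "X (x) Y" := (tens T X Y) (at level 40, only parsing).

Lemma tens_isomorphic X X' Y Y' :
  isomorphic X X' -> isomorphic Y Y' -> isomorphic (X (x) Y) (X' (x) Y').
Proof.
move=> XX' YY'; apply: (iso_trans (fmap_isomorphic (tens_r (tens T) Y) XX')).
exact: (fmap_isomorphic (tens_l (tens T) X') YY').
Qed.

Lemma tens_shl_isomorphic X Y : isomorphic (S X (x) Y) (S (X (x) Y)).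
Proof. exact: (exact_sh_isomorphic (tens_exactl Y) X). Qed.

Lemma tens_shr_isomorphic X Y : isomorphic (X (x) S Y) (S (X (x) Y)).
Proof. exact: (exact_sh_isomorphic (tens_exactr X) Y). Qed.

Lemma tens_triangle_l X A Y B :
  triangle A X B -> triangle (A (x) Y) (X (x) Y) (B (x) Y).
Proof. exact: (exact_triangle (tens_exactl Y)). Qed.

Lemma tens_triangle_r X A Y B :
  triangle A X B -> triangle (Y (x) A) (Y (x) X) (Y (x) B).
Proof. exact: (exact_triangle (tens_exactr Y)). Qed.

(** Additivity of degrees under the tensor product follows from the case of
    degree 0, moving first the second index and then the first. *)
Lemma shift_family_tens (P : int -> T -> Prop) : shift_family P ->
  (forall X Y, P 0 X -> P 0 Y -> P 0 (X (x) Y)) ->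
  forall a b X Y, P a X -> P b Y -> P (a + b) (X (x) Y).
Proof.
move=> PF P00 a b X Y; have [Ps Psh] := PF.
have P0b Z : P 0 Z -> P b Y -> P b (Z (x) Y).
  move=> PZ; elim/int_shift_ind: b Y => [Y|b]; first exact: P00.
  split=> IH Y PY.
  - apply/Psh; apply: (Ps _ _ _ (tens_shr_isomorphic _ _)).
    by apply: IH; apply/Psh.
  - have [Y' Y'Y] := iso_sh_surj Y.
    apply: (Ps _ _ _ (tens_isomorphic (iso_refl Z) Y'Y)).
    apply: (Ps _ _ _ (iso_sym (tens_shr_isomorphic _ _))); apply/Psh; apply: IH.
    by apply/Psh; apply: Ps PY; apply: iso_sym.
move=> + PY; elim/int_shift_ind: a X => [X|a].
  by rewrite add0r => /P0b; apply.
split=> IH X PX.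
- rewrite addrAC; apply/Psh; apply: (Ps _ _ _ (tens_shl_isomorphic _ _)).
  by apply: IH; apply/Psh.
- have [X' X'X] := iso_sh_surj X.
  apply: (Ps _ _ _ (tens_isomorphic X'X (iso_refl Y))).
  apply: (Ps _ _ _ (iso_sym (tens_shl_isomorphic _ _))).
  apply/Psh; rewrite addrAC.
  by apply: IH; apply/Psh; apply: Ps PX; apply: iso_sym.
Qed.

Section TensorReduced.
Variable t : tPair T.
Hypotheses (ht : is_tstructure t) (t_dev : dev t 0).
Hypothesis t_red : tensor_reduced (heart_tens t_dev).

Lemma tle_tens a b X Y : tle t a X -> tle t b Y -> tle t (a + b) (X (x) Y).
Proof. by apply: (shift_family_tens (tle_family t)); apply: t_dev.1. Qed.

Lemma tge_tens a b X Y : tge t a X -> tge t b Y -> tge t (a + b) (X (x) Y).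
Proof. by apply: (shift_family_tens (tge_family t)); apply: t_dev.2. Qed.

Lemma square_zero_sh X : is_zero (S X (x) S X) <-> is_zero (X (x) X).
Proof.
have e : isomorphic (S X (x) S X) (S (S (X (x) X))).
  apply: (iso_trans (tens_shl_isomorphic _ _)).
  exact: (fmap_isomorphic S (tens_shr_isomorphic _ _)).
split=> X0; first by do 2!apply: sh_reflects_zero; apply: (is_zero_iso e X0).
by apply: (is_zero_iso (iso_sym e)); do 2!apply: is_zero_fmap.
Qed.

(** Tensor reducedness concerns the heart; it extends to objects concentrated in
    any single degree as [(Sigma X) (x) (Sigma X)] is a double suspension of
    [X (x) X]. *)
Lemma square_zero n X :
  tle t n X -> tge t n X -> is_zero (X (x) X) -> is_zero X.
Proof.
elim/int_shift_ind: n X => [X Xl Xg XX0|n].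
  pose X' : heart t := exist _ X (conj Xl Xg).
  by apply/(full_sub_zero X')/t_red/full_sub_zero.
split=> IH X Xl Xg XX0.
- apply: sh_reflects_zero; apply: IH; [exact/tle_sh|exact/tge_sh|].
  exact/square_zero_sh.
- have [X' X'X] := iso_sh_surj X; have XX' := iso_sym X'X.
  apply: (is_zero_iso X'X (is_zero_fmap S _)); apply: IH.
  + by apply/tle_sh; apply: tle_strict Xl.
  + by apply/tge_sh; apply: tge_strict Xg.
  + by apply/square_zero_sh; apply: (is_zero_iso (tens_isomorphic XX' XX') XX0).
Qed.

(** With [A -> X -> B] the truncation at [n - 1], the objects [X (x) X],
    [B (x) X] and [B (x) B] differ by objects of [D^{<= 2n-1}].  So if the first
    lies in [D^{<= 2n-1}] then so does the last, which also lies in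
    [D^{>= 2n}] and thus vanishes: [B = 0]. *)
Lemma tle_drop n X :
  tle t n X -> tle t (n + n - 1) (X (x) X) -> tle t (n - 1) X.
Proof.
move=> Xn XXn; have [A [B [An Bn tri]]] := t_trunc ht (n - 1) X.
rewrite subrK in Bn.
have BnL : tle t n B.
  by apply: (tle_cone ht tri) => //; apply: tle_mono An => //; lia.
have BXn : tle t (n + n - 1) (B (x) X).
  apply: (tle_cone ht (tens_triangle_l X tri)) => //.
  by have := tle_tens An Xn; apply: tle_mono => //; lia.
have BBn : tle t (n + n - 1) (B (x) B).
  apply: (tle_cone ht (tens_triangle_r B tri)) => //.
  by have := tle_tens BnL An; apply: tle_mono => //; lia.
have BB0 : is_zero (B (x) B).
  by apply: (zero_of_gap ht BBn); rewrite subrK; apply: tge_tens.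
apply: tle_strict An.
exact: (triangle_zero_right tri (square_zero BnL Bn BB0)).
Qed.

(** The mirror argument for the lowest piece [A], through [X (x) X], [A (x) X]
    and [A (x) A]. *)
Lemma tge_drop n X :
  tge t n X -> tge t (n + n + 1) (X (x) X) -> tge t (n + 1) X.
Proof.
move=> Xn XXn; have [A [B [An Bn tri]]] := t_trunc ht n X.
have AnG : tge t n A.
  rewrite -(subrK 1 n); apply: (tge_cocone ht tri); rewrite ?subrK //.
  by apply: tge_mono Bn => //; lia.
have AXn : tge t (n + n + 1) (A (x) X).
  apply: (tge_cocone ht (tens_triangle_l X tri)) => //.
  by have := tge_tens Bn Xn; apply: tge_mono => //; lia.
have AAn : tge t (n + n + 1) (A (x) A).
  apply: (tge_cocone ht (tens_triangle_r A tri)) => //.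
  by have := tge_tens AnG Bn; apply: tge_mono => //; lia.
have AA0 : is_zero (A (x) A) by apply: (zero_of_gap ht _ AAn); apply: tle_tens.
apply: tge_strict Bn; apply: iso_sym.
exact: (triangle_zero_left tri (square_zero An AnG AA0)).
Qed.

(** Descent from [n] to [n - 1] by [tle_drop] is possible as long as
    [n <= 2n - 1], that is down to [n = 0]. *)
Lemma square_closed_tle (Q : T -> Prop) n :
  (forall X, Q X -> Q (X (x) X)) -> (forall X, Q X -> tle t n X) ->
  forall X, Q X -> tle t 0 X.
Proof.
move=> QQ; wlog n0 : n / 0 <= n => [IH Qn|].
  case: (leP 0 n) => [n0|n0]; first exact: (IH n).
  by apply: (IH 0) => // X /Qn; apply: tle_mono => //; lia.
case: n n0 => // n _; elim: n => // n IH Qn; apply: IH => X QX.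
have -> : Posz n = Posz n.+1 - 1 by lia.
apply: tle_drop; first exact: Qn.
by apply: tle_mono (Qn _ (QQ _ QX)) => //; lia.
Qed.

Lemma square_closed_tge (Q : T -> Prop) n :
  (forall X, Q X -> Q (X (x) X)) -> (forall X, Q X -> tge t n X) ->
  forall X, Q X -> tge t 0 X.
Proof.
move=> QQ; wlog n0 : n / n <= 0 => [IH Qn|].
  case: (leP n 0) => [n0|n0]; first exact: (IH n).
  by apply: (IH 0) => // X /Qn; apply: tge_mono => //; lia.
have -> : n = - Posz `|n|%N by lia.
elim: `|n|%N => // m IH Qm; apply: IH => X QX.
have -> : - Posz m = - Posz m.+1 + 1 by lia.
apply: tge_drop; first exact: Qm.
by apply: tge_mono (Qm _ (QQ _ QX)) => //; lia.
Qed.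

(** The objects isomorphic to the unit form a class closed under squares, which
    is bounded because the unit is. *)
Lemma unit_in_heart : is_bounded t -> in_heart t (mon_unit (mon T)).
Proof.
set U := mon_unit _; case=> /(_ U)[m Um] /(_ U)[n Un].
have UU X : isomorphic U X -> isomorphic U (X (x) X).
  move=> UX; apply: (iso_trans UX); apply: iso_sym.
  apply: (iso_trans (tens_isomorphic (iso_sym UX) (iso_refl X))).
  by exists (mon_l (mon T) X); apply: mon_l_iso.
split.
- by apply: (@square_closed_tle (isomorphic U) m) (iso_refl U) => // X UX;
    apply: tle_strict Um.
- by apply: (@square_closed_tge (isomorphic U) n) (iso_refl U) => // X UX;
    apply: tge_strict Un.
Qed.

(** Rigidity: among t-structures whose halves are closed under the tensor
    product, a tensor reduced one is alone in its equivalence class.  Closure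
    under squares gives one inclusion for each half, and the two inclusions
    are reversed by passing to orthogonals. *)
Lemma equivalent_tensor_reduced_eq (s : tPair T) :
  is_tstructure s -> dev s 0 -> t_equivalent s t ->
  (forall n X, tle s n X <-> tle t n X) /\
  (forall n X, tge s n X <-> tge t n X).
Proof.
move=> hs s_dev [m [n [_ mt tn]]].
have sm X : tle s m X -> tle t 0 X by move=> /mt/(tle0 ht).
have nt X : tle t 0 X -> tle s n X by move=> /(tle0 ht)/tn.
have sl X : tle s 0 X -> tle t 0 X.
  apply: (@square_closed_tle (tle s 0) (0 - m)) X => [X Xs|X Xs].
    by apply: s_dev.1.
  apply: (@shift_family_incl _ _ _ _ _ _ (tle_family s) (tle_family t) sm).
  by rewrite subrr.
have sg X : tge s 0 X -> tge t 0 X.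
  apply: (@square_closed_tge (tge s 0) (0 + 1 - (n + 1))) X => [X Xs|X Xs].
    by apply: s_dev.2.
  have ng Y : tge s (n + 1) Y -> tge t (0 + 1) Y.
    by move=> /(tgeP hs) Y0; apply/(tgeP ht) => W /nt; apply: Y0.
  apply: (@shift_family_incl _ _ _ _ _ _ (tge_family s) (tge_family t) ng).
  by rewrite addrN.
have sle j X : tle s j X -> tle t j X.
  have := @shift_family_incl _ _ _ _ _ _ (tle_family s) (tle_family t) sl j X.
  by rewrite add0r.
have sge j X : tge s j X -> tge t j X.
  have := @shift_family_incl _ _ _ _ _ _ (tge_family s) (tge_family t) sg j X.
  by rewrite add0r.
split=> j X; split=> [|Xt]; [exact: sle| |exact: sge|].
- by apply/(tleP hs) => Y /sge; apply: t_orth Xt.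
- apply/(tge_perp hs) => Y /sle Yt; apply: (t_orth ht Yt).
  by rewrite subrK.
Qed.

End TensorReduced.
End Tensor.

(** * Transport along an equivalence *)

Section Transport.
Variables (k : fieldType) (T1 T2 : triCat k) (F : linFunctor T1 T2).
Variable theta : forall X : T1, mor (F (sh T1 X)) (sh T2 (F X)).
Hypotheses (F_exact : is_exact_functor theta) (F_equiv : is_equivalence F).

Lemma ess_image_strict (P : T1 -> Prop) : strict_sub (ess_image F P).
Proof.
move=> X Y XY [X' [PX' FX'X]]; exists X'; split=> //.
exact: iso_trans FX'X XY.
Qed.

Lemma ess_image_obj (P : T1 -> Prop) X :
  strict_sub P -> ess_image F P (F X) <-> P X.
Proof.
move=> Ps; split=> [[X' [PX' FX'X]]|PX].
- exact: Ps (equiv_reflects_iso F_equiv FX'X) PX'.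
- by exists X; split=> //; apply: iso_refl.
Qed.

(** With this, all degrees of the transported pair are computed by comparing
    two families in one degree ([shift_family_eq]). *)
Lemma ess_image_family (P : int -> T1 -> Prop) :
  shift_family P -> shift_family (fun n => ess_image F (P n)).
Proof.
move=> [Ps Psh]; split=> [n|n X]; first exact: ess_image_strict.
split=> -[X' [PX' FX'X]].
- have [X'' X''X'] := iso_sh_surj X'; exists X''; split.
    by apply/Psh; apply: Ps PX'; apply: iso_sym.
  apply: sh_reflects_iso; apply: iso_trans _ FX'X.
  apply: (iso_trans (iso_sym (exact_sh_isomorphic F_exact X''))).
  exact: fmap_isomorphic.
- exists (sh T1 X'); split; first exact/Psh.
  apply: (iso_trans (exact_sh_isomorphic F_exact X')).
  exact: fmap_isomorphic.
Qed.

Variable t : tPair T1.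
Hypothesis ht : is_tstructure t.
Notation Ft := (image_tpair F t).

Lemma tle_image n X : tle Ft n X <-> ess_image F (tle t n) X.
Proof.
apply: (shift_family_eq (a := 0) (tle_family Ft)
         (ess_image_family (tle_family t))) => {n} {}X.
rewrite /tle oppr0.
rewrite shift_sub0; last exact: ess_image_strict.
by split=> -[X' [/(tle0 ht) ? ?]]; exists X'; split.
Qed.

Lemma tge_image n X : tge Ft n X <-> ess_image F (tge t n) X.
Proof.
apply: (shift_family_eq (a := 1) (tge_family Ft)
         (ess_image_family (tge_family t))) => {n} {}X.
rewrite /tge subrr.
rewrite shift_sub0; last exact: ess_image_strict.
by split=> -[X' [/(tge1 ht) ? ?]]; exists X'; split.
Qed.

Lemma in_heart_image X : in_heart Ft (F X) <-> in_heart t X.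
Proof.
rewrite /in_heart tle_image tge_image.
by rewrite !ess_image_obj //; [apply: tge_strict|apply: tle_strict].
Qed.

Lemma image_tstructure : is_tstructure Ft.
Proof.
split.
- exact: ess_image_strict.
- exact: ess_image_strict.
- move=> X [X' [X'U FX'X]]; exists (sh T1 X'); split.
    exact: ts_aisle_shift X'U.
  apply: (iso_trans (exact_sh_isomorphic F_exact X')).
  exact: fmap_isomorphic.
- move=> X [X' [X'V FX'X]]; have [Y [YV X'Y]] := ts_coaisle_shift ht X'V.
  exists (F Y); split; first by exists Y; split=> //; apply: iso_refl.
  apply: (iso_trans (iso_sym FX'X)).
  apply: iso_trans _ (exact_sh_isomorphic F_exact Y).
  exact: fmap_isomorphic.
- move=> X Y f [X' [X'U FX'X]] [Y' [Y'V FY'Y]].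
  apply: (hom0_iso FX'X FY'Y) => g; have [g' <-] := equiv_full F_equiv g.
  by rewrite (ts_orth ht g' X'U Y'V) fmap0.
- move=> X; have [X' FX'X] := equiv_ess_surj F_equiv X.
  have [A [B [a [p [d [AU BV apd]]]]]] := ts_triangle ht X'.
  have tri : triangle A X' B by exists a, p, d.
  have {a p d apd tri} [a [p [d apd]]] : triangle (F A) X (F B).
    apply: (triangle_iso (iso_refl _) FX'X (iso_refl _)).
    exact: exact_triangle F_exact _ _ _ tri.
  exists (F A), (F B), a, p, d; split=> //.
  + by exists A; split=> //; apply: iso_refl.
  + by exists B; split=> //; apply: iso_refl.
Qed.

Lemma image_bounded : is_bounded t -> is_bounded Ft.
Proof.
case=> bl bg; split=> X; have [X' FX'X] := equiv_ess_surj F_equiv X.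
- by have [n Xn] := bl X'; exists n; apply/tle_image; exists X'.
- by have [n Xn] := bg X'; exists n; apply/tge_image; exists X'.
Qed.

End Transport.

Section MonoidalTransport.
Variables (k : fieldType) (T1 T2 : mtCat k) (F : mtFunctor T1 T2).
Hypothesis F_equiv : is_equivalence F.

Lemma ess_image_tens (P Q R : T1 -> Prop) :
  (forall X Y, P X -> Q Y -> R (tens T1 X Y)) ->
  forall X Y, ess_image F P X -> ess_image F Q Y ->
    ess_image F R (tens T2 X Y).
Proof.
move=> PQR X Y [X' [PX' FX'X]] [Y' [QY' FY'Y]].
exists (tens T1 X' Y'); split; first exact: PQR.
apply: iso_trans _ (tens_isomorphic FX'X FY'Y); apply: iso_sym.
by exists (mtf_mu F X' Y'); apply: (sm_mu_iso (mtf_monoidal F)).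
Qed.

Lemma image_dev (t : tPair T1) n :
  is_tstructure t -> dev t n -> dev (image_tpair F t) n.
Proof.
move=> ht [devl devg]; have E := mtf_exact F; split=> X Y.
- move=> /(tle_image E ht) Xl /(tle_image E ht) Yl.
  by apply/(tle_image E ht); apply: (ess_image_tens devl).
- move=> /(tge_image E ht) Xg /(tge_image E ht) Yg.
  by apply/(tge_image E ht); apply: (ess_image_tens devg).
Qed.

Lemma image_monoidal_tstructure (t : tPair T1) :
  is_monoidal_tstructure t -> is_monoidal_tstructure (image_tpair F t).
Proof.
case=> ht bt [n dt]; have E := mtf_exact F; split.
- exact: (image_tstructure E F_equiv ht).
- exact: (image_bounded E F_equiv ht).
- by exists n; apply: image_dev.
Qed.

End MonoidalTransport.

(** * The monoidal structure of the heart *)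

Section HeartMonoidal.
Variables (k : fieldType) (T : mtCat k) (t : tPair T).
Hypotheses (ht : is_tstructure t) (t_dev : dev t 0).
Hypothesis unitH : in_heart t (mon_unit (mon T)).
Notation M := (mon T).

(** Once the unit is in the heart, all the coherence data of [T] are maps of the
    heart. *)
Definition heart_monoidal : monoidal (heart_tens t_dev).
Proof.
pose U : heart t := exist _ (mon_unit M) unitH.
refine (@Monoidal k (heart t) (heart_tens t_dev) U
  (fun X Y Z => mon_a M (sval X) (sval Y) (sval Z))
  (fun X => mon_l M (sval X)) (fun X => mon_r M (sval X))
  _ _ _ _ _ _ _ _).
- move=> X Y Z; exact/full_sub_is_iso/mon_a_iso.
- by move=> X X' Y Y' Z Z' f g h; apply: (mon_a_nat M f g h).
- move=> X; exact/full_sub_is_iso/mon_l_iso.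
- by move=> X X' f; apply: (mon_l_nat M f).
- move=> X; exact/full_sub_is_iso/mon_r_iso.
- by move=> X X' f; apply: (mon_r_nat M f).
- move=> X Y Z W.
  exact: (mon_pentagon M (sval X) (sval Y) (sval Z) (sval W)).
- by move=> X Y; apply: (mon_triangle M (sval X) (sval Y)).
Defined.

(** Both truncation triangles of an object of the heart are trivial, with zero
    third vertex. *)
Lemma is_H0_id (X : T) : in_heart t X -> is_H0 t (idmor X) (idmor X).
Proof.
move=> [Xl Xg]; have [Z [Z0 dX]] := tr1_id X.
have Zl : tle t (-1) Z.
  by apply/(tleP ht) => Y _ f; rewrite (Z0.1 _ f).
have Zg : tge t 1 Z.
  by apply/(tge_perp ht) => Y _ f; rewrite (Z0.2 _ f).
split.
- by exists Z, 0, 0; split=> //; apply: dist_zero_id Z0.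
- by exists Z, 0, 0; split.
Qed.

Lemma heart_monoidalP : is_heart_monoidal heart_monoidal.
Proof.
(* The unit is its own [H^0], with identities as truncation maps. *)
split=> [//|]; exists (mon_unit M), (idmor _), (idmor _); split.
- exact: is_H0_id.
- move=> X; have [v vI] := mon_l_iso M (sval X); exists v; split=> //.
  by rewrite tmap_id mcomp1m; case: vI.
- move=> X; have [v vI] := mon_r_iso M (sval X); exists v; split=> //.
  by rewrite tmap_id mcomp1m; case: vI.
Qed.

End HeartMonoidal.

Section RestrictMonoidal.
Variables (k : fieldType) (T1 T2 : mtCat k) (F : mtFunctor T1 T2).
Variables (t1 : tPair T1) (t2 : tPair T2) (h1 : dev t1 0) (h2 : dev t2 0).
Variable hF : forall X : T1, in_heart t1 X -> in_heart t2 (F X).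
Variable unit1 : in_heart t1 (mon_unit (mon T1)).
Variable unit2 : in_heart t2 (mon_unit (mon T2)).

Lemma restrict_strong_monoidal :
  @is_strong_monoidal _ _ _ _ _ (heart_monoidal h1 unit1)
    (heart_monoidal h2 unit2) _ (restrict_mu h1 h2 hF) (mtf_eps F).
Proof.
have FM := mtf_monoidal F; split.
- move=> X Y; exact/full_sub_is_iso/(sm_mu_iso FM).
- move=> X X' Y Y' f g; exact: (sm_mu_nat FM f g).
- exact/full_sub_is_iso/(sm_eps_iso FM).
- move=> X Y Z; exact: (sm_assoc FM (sval X) (sval Y) (sval Z)).
- move=> X; exact: (sm_unit_l FM (sval X)).
- move=> X; exact: (sm_unit_r FM (sval X)).
Qed.

End RestrictMonoidal.

Theorem corollary2p24 (k : closedFieldType) (T1 T2 : mtCat k)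
  (F : mtFunctor T1 T2) (F_equiv : is_equivalence F)
  (T1_nonzero : nonzero_cat T1) (T2_nonzero : nonzero_cat T2)
  (t1 : tPair T1) (t2 : tPair T2)
  (t1_mon : is_monoidal_tstructure t1) (t2_mon : is_monoidal_tstructure t2) :
  is_monoidal_tstructure (image_tpair F t1) /\
  (forall (h1 : dev t1 0) (h2 : is_tensor_reduced_tstructure t2),
     t_equivalent (image_tpair F t1) t2 ->
     exists (hF : forall X : T1, in_heart t1 X -> in_heart t2 (F X))
            (M1 : monoidal (heart_tens h1))
            (M2 : monoidal (heart_tens (trt_dev h2)))
            (eps : mor (mon_unit M2) (restrict_functor hF (mon_unit M1))),
       [/\ is_heart_monoidal M1, is_heart_monoidal M2
         & monoidal_abelian_equivalence
             (restrict_mu h1 (trt_dev h2) hF) eps]).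
Proof.
have mon_t := image_monoidal_tstructure F_equiv t1_mon.
split=> // h1 h2 teq; have E := mtf_exact F.
have [ht1 bt1 _] := t1_mon; have [ht2 bt2 _] := t2_mon.
have [lE gE] := equivalent_tensor_reduced_eq ht2 (trt_reduced h2)
  (mts_tstructure mon_t) (image_dev F ht1 h1) teq.
have heartE X : in_heart t2 (F X) <-> in_heart t1 X.
  rewrite -(in_heart_image E F_equiv ht1).
  by rewrite /in_heart lE gE.
have hF X : in_heart t1 X -> in_heart t2 (F X) by move=> /heartE.
have unit2 := unit_in_heart ht2 (trt_reduced h2) bt2.
have unit1 : in_heart t1 (mon_unit (mon T1)).
  apply/heartE; apply: in_heart_iso unit2.
  by exists (mtf_eps F); apply: (sm_eps_iso (mtf_monoidal F)).
exists hF, (heart_monoidal h1 unit1), (heart_monoidal (trt_dev h2) unit2).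
exists (mtf_eps F); split; try exact: heart_monoidalP.
split; try exact: heart_abelian.
- exact: restrict_strong_monoidal.
- apply: restrict_equivalence => // [X Y|X /heartE //].
  exact: in_heart_iso.
Qed.
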